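(* Let $(\mathcal B,\mathbb E,\mathfrak s)$ be an extriangulated category with enough projectives, and let $(\mathcal U,\mathcal V)$ be any cotorsion pair on it, with heart $\underline{\mathcal H}$, coheart $\mathcal C$ and kernel $\mathcal K$. The following are equivalent. (1) Any object $B\in\underline{\mathcal H}$ admits an epimorphism $X\to B$ in $\underline{\mathcal H}$ from some $X\in H(\Omega\mathcal C)$. (In particular, since objects of $H(\Omega\mathcal C)$ are projective in $\underline{\mathcal H}$, $\underline{\mathcal H}$ has enough projectives in this case.) (2) $(\mathcal C,\mathcal K)$ is a cotorsion pair on $\mathcal B$. (3) $\mathcal B=\mathrm{CoCone}(\mathcal K,\mathcal C)$. (4) $\mathcal U\subseteq\mathrm{Cone}(\mathcal K,\mathcal C)$. Moreover, in this case, the subcategory of projectives in $\underline{\mathcal H}$ agrees with $\mathrm{add}(H(\Omega\mathcal C))$, where $\mathrm{add}$ denotes the closure under taking direct summands in $\underline{\mathcal H}$.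
   Context: Extriangulated category $(\mathcal B,\mathbb E,\mathfrak s)$: (ET1) $\mathcal B$ is an additive category and $\mathbb E\colon\mathcal B^{\mathrm{op}}\times\mathcal B\to \mathrm{Ab}$ is an additive bifunctor; for $\delta\in\mathbb E(C,A)$, $a\colon A\to A'$, $c\colon C'\to C$ write $a_*\delta=\mathbb E(C,a)(\delta)$ and $c^*\delta=\mathbb E(c,A)(\delta)$. Sequences $A\to B\to C$ and $A\to B'\to C$ are equivalent if there is an isomorphism $B\cong B'$ compatible with the identities of $A$ and $C$. $\mathfrak s$ assigns to each $\delta\in\mathbb E(C,A)$ an equivalence class $\mathfrak s(\delta)=[A\xrightarrow{x}B\xrightarrow{y}C]$; we say $A\xrightarrow{x}B\xrightarrow{y}C$ realizes $\delta$. (ET2) $\mathfrak s$ is an additive realization: if $A\xrightarrow{x}B\xrightarrow{y}C$ realizes $\delta$, $A'\xrightarrow{x'}B'\xrightarrow{y'}C'$ realizes $\delta'$ and $a\colon A\to A'$, $c\colon C\to C'$ satisfy $a_*\delta=c^*\delta'$, then there is $b\colon B\to B'$ with $bx=x'a$, $y'b=cy$; $0\in\mathbb E(C,A)$ is realized by the split sequence $A\to A\oplus C\to C$; and $\mathfrak s(\delta\oplus\delta')=\mathfrak s(\delta)\oplus\mathfrak s(\delta')$. (ET3) If $A\xrightarrow{x}B\xrightarrow{y}C$ realizes $\delta\in\mathbb E(C,A)$, $A'\xrightarrow{x'}B'\xrightarrow{y'}C'$ realizes $\delta'\in\mathbb E(C',A')$ and $a\colon A\to A'$, $b\colon B\to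 B'$ satisfy $bx=x'a$, then there is $c\colon C\to C'$ with $cy=y'b$ and $a_*\delta=c^*\delta'$; and (ET3)$^{\mathrm{op}}$, its dual. (ET4) If $\delta\in\mathbb E(D,A)$ and $\delta'\in\mathbb E(F,B)$ are realized by $A\xrightarrow{f}B\xrightarrow{f'}D$ and $B\xrightarrow{g}C\xrightarrow{g'}F$, there are an object $E$, morphisms $d\colon D\to E$, $e\colon E\to F$, $h'\colon C\to E$ with $h'g=df'$, $eh'=g'$, and $\delta''\in\mathbb E(E,A)$ realized by $A\xrightarrow{gf}C\xrightarrow{h'}E$, such that $D\xrightarrow{d}E\xrightarrow{e}F$ realizes $f'_*\delta'$, $d^*\delta''=\delta$ and $f_*\delta''=e^*\delta'$; and (ET4)$^{\mathrm{op}}$, its dual. A conflation $A\rightarrowtail B\twoheadrightarrow C$ is a sequence realizing some $\delta\in\mathbb E(C,A)$; its second morphism is called a deflation. An object $P$ is projective if $\mathbb E(P,\mathcal B)=0$; $\mathcal P$ is the full subcategory of projectives; $\mathcal B$ has enough projectives if every object $B$ admits a deflation $P\to B$ with $P\in\mathcal P$. For full subcategories $\mathcal X,\mathcal Y\subseteq\mathcal B$: $\mathrm{Cone}(\mathcal X,\mathcal Y)$ is the full subcategory of objects $B$ admitting a conflation $X\rightarrowtail Y\twoheadrightarrow B$, and $\mathrm{CoCone}(\mathcal X,\mathcal Y)$ that of objects $B$ admitting a conflation $B\rightarrowtail X\twoheadrightarrow Y$, and $\mathcal X\ast\mathcal Y$ that of objects $B$ admitting a conflation $X\rightarrowtail B\twoheadrightarrow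 Y$, with $X\in\mathcal X$, $Y\in\mathcal Y$. A cotorsion pair $(\mathcal U,\mathcal V)$ on $\mathcal B$ is a pair of full additive subcategories closed under direct summands and isomorphisms with $\mathbb E(\mathcal U,\mathcal V)=0$ and such that every $B\in\mathcal B$ admits conflations $V_B\rightarrowtail U_B\twoheadrightarrow B$ and $B\rightarrowtail V^B\twoheadrightarrow U^B$ with $U_B,U^B\in\mathcal U$, $V_B,V^B\in\mathcal V$. Put $\mathcal W=\mathcal U\cap\mathcal V$, $\mathcal B^+=\mathrm{Cone}(\mathcal V,\mathcal W)$, $\mathcal B^-=\mathrm{CoCone}(\mathcal W,\mathcal U)$, $\mathcal H=\mathcal B^+\cap\mathcal B^-$, $\underline{\mathcal B}=\mathcal B/\mathcal W$ (ideal quotient by morphisms factoring through $\mathcal W$; $\underline f$ is the image of $f$), $\underline{\mathcal B}^{\pm}=\mathcal B^{\pm}/\mathcal W$. The heart is $\underline{\mathcal H}=\mathcal H/\mathcal W$, which is an abelian category. A reflection sequence for $B$ is a conflation $B\overset{z}{\rightarrowtail}Z\twoheadrightarrow U$ with $Z\in\mathcal B^+$, $U\in\mathcal U$ such that $z^*\colon\mathbb E(Z,V)\to\mathbb E(B,V)$ is surjective for all $V\in\mathcal V$. A coreflection sequence for $B$ is a conflation $V\rightarrowtail X\overset{x}{\twoheadrightarrow}B$ with $X\in\mathcal B^-$, $V\in\mathcal V$ such that $x_*\colon\mathbb E(U,X)\to\mathbb E(U,B)$ is surjective for all $U\in\mathcal U$. Every object has both. For each $B$ choose a reflection sequence $B\overset{p_B}{\rightarrowtail}B^+\twoheadrightarrow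 U$ and a coreflection sequence $V\rightarrowtail B^-\overset{m_B}{\twoheadrightarrow}B$ (with $B^{\pm}=B$ and identity map if $B\in\mathcal B^{\pm}$). The functor $\sigma^+\colon\underline{\mathcal B}\to\underline{\mathcal B}^+$ is $B\mapsto B^+$, with $\sigma^+(\underline f)$ for $f\colon B\to C$ the unique morphism satisfying $\sigma^+(\underline f)\,\underline{p_B}=\underline{p_C}\,\underline f$; dually $\sigma^-\colon\underline{\mathcal B}\to\underline{\mathcal B}^-$ is $B\mapsto B^-$, with $\underline{m_C}\,\sigma^-(\underline f)=\underline f\,\underline{m_B}$. With $\pi\colon\mathcal B\to\underline{\mathcal B}$ the quotient functor, $H=\sigma^-\circ\sigma^+\circ\pi\colon\mathcal B\to\underline{\mathcal H}$. The kernel of $(\mathcal U,\mathcal V)$ is $\mathcal K=\mathrm{add}(\mathcal U\ast\mathcal V)$ ($\mathrm{add}$ = closure under direct summands in $\mathcal B$). The coheart is $\mathcal C={}^{\perp_1}\mathcal K=\mathcal U\cap{}^{\perp_1}\mathcal U$, where ${}^{\perp_1}\mathcal X=\{X\in\mathcal B\mid\mathbb E(X,\mathcal X)=0\}$. Put $\Omega\mathcal C=\mathrm{CoCone}(\mathcal P,\mathcal C)$, and let $H(\Omega\mathcal C)\subseteq\underline{\mathcal H}$ be the essential image of $\Omega\mathcal C$ under $H$. *)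

(* Defs.v *)
From HB Require Import structures.
From mathcomp Require Import all_boot all_algebra.
From mathcomp Require Import boolp.

(* MathComp; [boolp] supplies choice and decidable propositions, which is what
   makes quotients of arbitrary hom-groups available as [zmodType]s. *)

Set Implicit Arguments.
Unset Strict Implicit.
Unset Printing Implicit Defensive.

Import GRing.Theory.
Local Open Scope ring_scope.
Local Open Scope quotient_scope.

Record preaddcat := PreAddCat {
  obj :> Type;
  mor : obj -> obj -> zmodType;
  idm : forall a, mor a a;
  cmp : forall a b c, mor b c -> mor a b -> mor a c;
  cmpA : forall a b c d (h : mor c d) (g : mor b c) (f : mor a b),
    cmp h (cmp g f) = cmp (cmp h g) f;
  cmp1m : forall a b (f : mor a b), cmp (idm b) f = f;
  cmpm1 : forall a b (f : mor a b), cmp f (idm a) = f;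
  cmpDl : forall a b c (g g' : mor b c) (f : mor a b),
    cmp (g + g') f = cmp g f + cmp g' f;
  cmpDr : forall a b c (g : mor b c) (f f' : mor a b),
    cmp g (f + f') = cmp g f + cmp g f' }.

Arguments mor {p} _ _.
Arguments idm {p} a.
Arguments cmp {p a b c} _ _.

Notation "g \oc f" := (cmp g f) (at level 40, left associativity) : ring_scope.

Section CategoryNotions.
Variable C : preaddcat.
Implicit Types (a b c s z : C) (X : C -> Prop).

Definition is_iso a b (f : mor a b) : Prop :=
  exists g : mor b a, g \oc f = idm a /\ f \oc g = idm b.

Definition isomorphic a b : Prop := exists f : mor a b, is_iso f.

Definition is_epi a b (f : mor a b) : Prop :=
  forall c (g h : mor b c), g \oc f = h \oc f -> g = h.

Definition is_zero z : Prop :=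
  forall a, (forall f : mor z a, f = 0) /\ (forall f : mor a z, f = 0).

Definition is_biprod a b s
    (i1 : mor a s) (i2 : mor b s) (p1 : mor s a) (p2 : mor s b) : Prop :=
  [/\ p1 \oc i1 = idm a, p2 \oc i2 = idm b, p1 \oc i2 = 0, p2 \oc i1 = 0
    & i1 \oc p1 + i2 \oc p2 = idm s].

(* Idempotents need not split, so a summand must come with a complement: being
   a retract would not be enough. *)
Definition is_summand a s : Prop :=
  exists b (i1 : mor a s) (i2 : mor b s) (p1 : mor s a) (p2 : mor s b),
    is_biprod i1 i2 p1 p2.

Definition add_closure X : C -> Prop := fun a => exists s, X s /\ is_summand a s.

Definition is_additive_subcat X : Prop :=
  (exists z, is_zero z /\ X z) /\
  (forall a b s (i1 : mor a s) (i2 : mor b s) (p1 : mor s a) (p2 : mor s b),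
     is_biprod i1 i2 p1 p2 -> X a -> X b -> X s).

Definition iso_closed X : Prop := forall a b, isomorphic a b -> X a -> X b.

Definition summand_closed X : Prop := forall a s, is_summand a s -> X s -> X a.

(* Projective objects in the usual sense, lifting against epimorphisms; not to
   be confused with the projectives [ext_projective] of an extriangulated
   category. *)
Definition cat_projective a : Prop :=
  forall b c (e : mor b c) (f : mor a c), is_epi e ->
    exists g : mor a b, e \oc g = f.

Definition cat_enough_projectives : Prop :=
  forall b, exists a, cat_projective a /\ exists e : mor a b, is_epi e.

End CategoryNotions.

Record addcat := AddCat {
  addcat_pre :> preaddcat;
  addcat_zero : exists z : addcat_pre, is_zero z;
  addcat_biprod : forall a b : addcat_pre,
    exists s (i1 : mor a s) (i2 : mor b s) (p1 : mor s a) (p2 : mor s b),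
      is_biprod i1 i2 p1 p2 }.

Section Composition.
Variable C : preaddcat.
Implicit Types a b c : C.

Lemma cmp0m a b c (f : mor a b) : (0 : mor b c) \oc f = 0.
Proof. by apply: (@addrI _ ((0 : mor b c) \oc f)); rewrite -cmpDl !addr0. Qed.

Lemma cmpm0 a b c (g : mor b c) : g \oc (0 : mor a b) = 0.
Proof. by apply: (@addrI _ (g \oc (0 : mor a b))); rewrite -cmpDr !addr0. Qed.

Lemma cmpNm a b c (g : mor b c) (f : mor a b) : (- g) \oc f = - (g \oc f).
Proof. by apply: (@addrI _ (g \oc f)); rewrite -cmpDl !subrr cmp0m. Qed.

Lemma cmpmN a b c (g : mor b c) (f : mor a b) : g \oc (- f) = - (g \oc f).
Proof. by apply: (@addrI _ (g \oc f)); rewrite -cmpDr !subrr cmpm0. Qed.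

Lemma cmpBl a b c (g g' : mor b c) (f : mor a b) :
  (g - g') \oc f = g \oc f - g' \oc f.
Proof. by rewrite cmpDl cmpNm. Qed.

Lemma cmpBr a b c (g : mor b c) (f f' : mor a b) :
  g \oc (f - f') = g \oc f - g \oc f'.
Proof. by rewrite cmpDr cmpmN. Qed.

End Composition.

Record functor (C D : preaddcat) := Functor {
  fobj :> C -> D;
  fmap : forall a b, mor a b -> mor (fobj a) (fobj b);
  fmap1 : forall a, fmap (idm a) = idm (fobj a);
  fmapM : forall a b c (g : mor b c) (f : mor a b),
    fmap (g \oc f) = fmap g \oc fmap f }.

Definition fcomp (C D E : preaddcat) (G : functor D E) (F : functor C D) :
  functor C E.
Proof.
exists (fun a => G (F a)) (fun a b f => fmap G (fmap F f)).
- by move=> a; rewrite !fmap1.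
- by move=> a b c g f; rewrite !fmapM.
Defined.

Definition ess_image (C D : preaddcat) (F : functor C D) (X : C -> Prop) :
  D -> Prop := fun d => exists c, X c /\ isomorphic (F c) d.

Definition full_sub (C : preaddcat) (X : C -> Prop) : preaddcat.
Proof.
exists {a : C | X a} (fun a b => mor (sval a) (sval b)) (fun a => idm (sval a))
  (fun a b c g f => g \oc f).
- by move=> *; exact: cmpA.
- by move=> *; exact: cmp1m.
- by move=> *; exact: cmpm1.
- by move=> *; exact: cmpDl.
- by move=> *; exact: cmpDr.
Defined.

Definition incl (C : preaddcat) (X : C -> Prop) : functor (full_sub X) C.
Proof. by exists (fun a : full_sub X => sval a) (fun a b f => f). Defined.

Definition corestrict (C D : preaddcat) (X Y : D -> Prop)
    (F : functor C (full_sub X)) (h : forall c, Y (sval (F c))) :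
  functor C (full_sub Y).
Proof.
exists (fun c => exist _ (sval (F c)) (h c) : full_sub Y)
  (fun a b f => fmap F f : mor (sval (F a)) (sval (F b))).
- by move=> a; exact: (fmap1 F a).
- by move=> a b c g f; exact: (fmapM F g f).
Defined.

Definition factors (C : preaddcat) (W : C -> Prop) (a b : C) (f : mor a b) :
    Prop :=
  exists w, W w /\ exists (g : mor a w) (h : mor w b), f = h \oc g.

Definition factor_pred (C : addcat) (W : C -> Prop)
    (hW : is_additive_subcat W) (a b : C) : {pred mor a b} :=
  fun f => `[< factors W f >].
Arguments factor_pred {C W} hW a b _.

Section Quotient.
Variables (C : addcat) (W : C -> Prop) (hW : is_additive_subcat W).
Implicit Types a b c : C.

Lemma factor_predP a b (f : mor a b) :
  reflect (factors W f) (f \in factor_pred hW a b).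
Proof. exact: asboolP. Qed.

Lemma factor_pred_closed a b : zmod_closed (factor_pred hW a b).
Proof.
have [[z [_ Wz]] Wbp] := hW.
split=> [|f f' /factor_predP[w [Ww [g [h ->]]]]
    /factor_predP[w' [Ww' [g' [h' ->]]]]].
  by apply/factor_predP; exists z; split=> //; exists 0, 0; rewrite cmp0m.
have [s [i1 [i2 [p1 [p2 bp]]]]] := addcat_biprod w w'.
apply/factor_predP; exists s; split; first exact: Wbp bp Ww Ww'.
case: bp => e11 e22 e12 e21 _.
exists (i1 \oc g + i2 \oc g'), (h \oc p1 - h' \oc p2).
rewrite cmpBl !cmpDr -!cmpA !(cmpA p1) !(cmpA p2) e11 e22 e12 e21.
by rewrite !cmp1m !cmp0m !cmpm0 addr0 add0r.
Qed.

HB.instance Definition _ a b :=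
  GRing.isZmodClosed.Build (mor a b) (factor_pred hW a b)
    (@factor_pred_closed a b).

Lemma factors_cmpl a b c (g : mor b c) (f : mor a b) :
  factors W f -> factors W (g \oc f).
Proof.
by case=> w [Ww [h [k ->]]]; exists w; split=> //; exists h, (g \oc k);
  rewrite cmpA.
Qed.

Lemma factors_cmpr a b c (g : mor b c) (f : mor a b) :
  factors W g -> factors W (g \oc f).
Proof.
by case=> w [Ww [h [k ->]]]; exists w; split=> //; exists (h \oc f), k;
  rewrite cmpA.
Qed.

Definition quot_mor a b : zmodType := Quotient.quot (factor_pred hW a b).

Definition quot_pi a b (f : mor a b) : quot_mor a b := \pi_(quot_mor a b) f.

Lemma quot_piP a b (f g : mor a b) :
  quot_pi f = quot_pi g <-> factors W (f - g).
Proof.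
split=> [e|/factor_predP].
  by apply/factor_predP; rewrite Quotient.idealrBE; apply/eqP.
by rewrite Quotient.idealrBE => /eqP.
Qed.

Lemma quot_piK a b (f : quot_mor a b) : quot_pi (repr f) = f.
Proof. exact: reprK. Qed.

Lemma quot_piD a b (f g : mor a b) : quot_pi (f + g) = quot_pi f + quot_pi g.
Proof. exact: raddfD. Qed.

Definition quot_cmp a b c (g : quot_mor b c) (f : quot_mor a b) :
  quot_mor a c := quot_pi (repr g \oc repr f).

Lemma quot_cmpE a b c (g : mor b c) (f : mor a b) :
  quot_cmp (quot_pi g) (quot_pi f) = quot_pi (g \oc f).
Proof.
have Eg : factors W (repr (quot_pi g) - g) by apply/quot_piP; exact: quot_piK.
have Ef : factors W (repr (quot_pi f) - f) by apply/quot_piP; exact: quot_piK.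
transitivity (quot_pi (g \oc repr (quot_pi f))); apply/quot_piP.
  by rewrite -cmpBl; exact: factors_cmpr.
by rewrite -cmpBr; exact: factors_cmpl.
Qed.

Definition quot_cat : preaddcat.
Proof.
exists C quot_mor (fun a => quot_pi (idm a)) quot_cmp.
- move=> a b c d h g f; rewrite -(quot_piK h) -(quot_piK g) -(quot_piK f).
  by rewrite !quot_cmpE cmpA.
- by move=> a b f; rewrite -(quot_piK f) quot_cmpE cmp1m.
- by move=> a b f; rewrite -(quot_piK f) quot_cmpE cmpm1.
- move=> a b c g g' f; rewrite -(quot_piK g) -(quot_piK g') -(quot_piK f).
  by rewrite -quot_piD !quot_cmpE cmpDl quot_piD.
- move=> a b c g f f'; rewrite -(quot_piK g) -(quot_piK f) -(quot_piK f').
  by rewrite -quot_piD !quot_cmpE cmpDr quot_piD.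
Defined.

Definition quot_functor : functor C quot_cat.
Proof.
exists (fun a => a : quot_cat) quot_pi => // a b c g f.
by rewrite -quot_cmpE.
Defined.

End Quotient.

Definition seqn (C : preaddcat) (a c : C) : Type :=
  {b : C & (mor a b * mor b c)%type}.

Definition seqn_equiv (C : preaddcat) (a c : C) (S S' : seqn a c) : Prop :=
  exists f : mor (projT1 S) (projT1 S'),
    [/\ is_iso f, f \oc (projT2 S).1 = (projT2 S').1
      & (projT2 S').2 \oc f = (projT2 S).2].

(* [ext c a] is E(C, A), [push a] is a_* and [pull c] is c^*.  The value of the
   realization at d is an equivalence class, given as a set of sequences. *)
Record preextricat := PreExtriCat {
  pet_cat :> addcat;
  ext : pet_cat -> pet_cat -> zmodType;
  push : forall c a a' : pet_cat, mor a a' -> ext c a -> ext c a';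
  pull : forall c c' a : pet_cat, mor c' c -> ext c a -> ext c' a;
  push1 : forall c a (d : ext c a), push (idm a) d = d;
  pull1 : forall c a (d : ext c a), pull (idm c) d = d;
  pushM : forall c a a' a'' (g : mor a' a'') (f : mor a a') (d : ext c a),
    push (g \oc f) d = push g (push f d);
  pullM : forall c c' c'' a (g : mor c' c) (f : mor c'' c') (d : ext c a),
    pull (g \oc f) d = pull f (pull g d);
  push_pull : forall c c' a a' (f : mor a a') (g : mor c' c) (d : ext c a),
    push f (pull g d) = pull g (push f d);
  pushDr : forall c a a' (f : mor a a') (d d' : ext c a),
    push f (d + d') = push f d + push f d';
  pullDr : forall c c' a (g : mor c' c) (d d' : ext c a),
    pull g (d + d') = pull g d + pull g d';
  pushDl : forall c a a' (f f' : mor a a') (d : ext c a),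
    push (f + f') d = push f d + push f' d;
  pullDl : forall c c' a (g g' : mor c' c) (d : ext c a),
    pull (g + g') d = pull g d + pull g' d;
  realization : forall c a, ext c a -> seqn a c -> Prop;
  realization_class : forall c a (d : ext c a),
    exists S, forall S', realization d S' <-> seqn_equiv S S' }.

Arguments ext {p} _ _.
Arguments push {p c a a'} _ _.
Arguments pull {p c c' a} _ _.
Arguments realization {p c a} _ _.

Definition realizes (B : preextricat) (a b c : B) (d : ext c a)
    (x : mor a b) (y : mor b c) : Prop :=
  realization d (existT _ b (x, y)).

Section ETAxioms.
Variable B : preextricat.

Definition ET2_morphism : Prop :=
  forall (a b c a' b' c' : B) (d : ext c a) (d' : ext c' a')
    (x : mor a b) (y : mor b c) (x' : mor a' b') (y' : mor b' c')
    (f : mor a a') (h : mor c c'),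
  realizes d x y -> realizes d' x' y' -> push f d = pull h d' ->
  exists g : mor b b', g \oc x = x' \oc f /\ y' \oc g = h \oc y.

Definition ET2_split : Prop :=
  forall (a c s : B) (i1 : mor a s) (i2 : mor c s) (p1 : mor s a) (p2 : mor s c),
  is_biprod i1 i2 p1 p2 -> realizes (0 : ext c a) i1 p2.

Definition ext_sum (a a' sa c c' sc : B) (ia : mor a sa) (ia' : mor a' sa)
    (pc : mor sc c) (pc' : mor sc c') (d : ext c a) (d' : ext c' a') :
  ext sc sa := push ia (pull pc d) + push ia' (pull pc' d').

Definition ET2_sum : Prop :=
  forall (a a' sa : B) (ia : mor a sa) (ia' : mor a' sa)
    (pa : mor sa a) (pa' : mor sa a')
    (b b' sb : B) (ib : mor b sb) (ib' : mor b' sb)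
    (pb : mor sb b) (pb' : mor sb b')
    (c c' sc : B) (ic : mor c sc) (ic' : mor c' sc)
    (pc : mor sc c) (pc' : mor sc c')
    (d : ext c a) (d' : ext c' a')
    (x : mor a b) (y : mor b c) (x' : mor a' b') (y' : mor b' c'),
  is_biprod ia ia' pa pa' -> is_biprod ib ib' pb pb' -> is_biprod ic ic' pc pc' ->
  realizes d x y -> realizes d' x' y' ->
  realizes (ext_sum ia ia' pc pc' d d')
    (ib \oc x \oc pa + ib' \oc x' \oc pa') (ic \oc y \oc pb + ic' \oc y' \oc pb').

Definition ET3 : Prop :=
  forall (a b c a' b' c' : B) (d : ext c a) (d' : ext c' a')
    (x : mor a b) (y : mor b c) (x' : mor a' b') (y' : mor b' c')
    (f : mor a a') (g : mor b b'),
  realizes d x y -> realizes d' x' y' -> g \oc x = x' \oc f ->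
  exists h : mor c c', h \oc y = y' \oc g /\ push f d = pull h d'.

Definition ET3op : Prop :=
  forall (a b c a' b' c' : B) (d : ext c a) (d' : ext c' a')
    (x : mor a b) (y : mor b c) (x' : mor a' b') (y' : mor b' c')
    (g : mor b b') (h : mor c c'),
  realizes d x y -> realizes d' x' y' -> h \oc y = y' \oc g ->
  exists f : mor a a', g \oc x = x' \oc f /\ push f d = pull h d'.

Definition ET4 : Prop :=
  forall (A B1 C D F : B) (dl : ext D A) (dl' : ext F B1)
    (f : mor A B1) (f' : mor B1 D) (g : mor B1 C) (g' : mor C F),
  realizes dl f f' -> realizes dl' g g' ->
  exists (E : B) (d : mor D E) (e : mor E F) (h' : mor C E) (dl'' : ext E A),
    (h' \oc g = d \oc f' /\ e \oc h' = g') /\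
    realizes dl'' (g \oc f) h' /\
    [/\ realizes (push f' dl') d e, pull d dl'' = dl & push f dl'' = pull e dl'].

(* [ET4] in the opposite category, under the same names for objects and for the
   reversed morphisms. *)
Definition ET4op : Prop :=
  forall (A B1 C D F : B) (dl : ext A D) (dl' : ext B1 F)
    (f : mor B1 A) (f' : mor D B1) (g : mor C B1) (g' : mor F C),
  realizes dl f' f -> realizes dl' g' g ->
  exists (E : B) (d : mor E D) (e : mor F E) (h' : mor E C) (dl'' : ext A E),
    (g \oc h' = f' \oc d /\ h' \oc e = g') /\
    realizes dl'' h' (f \oc g) /\
    [/\ realizes (pull f' dl') e d, push d dl'' = dl & pull f dl'' = push e dl'].

End ETAxioms.

Record extricat := ExtriCat {
  et_pre :> preextricat;
  et2_morphism : ET2_morphism et_pre;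
  et2_split : ET2_split et_pre;
  et2_sum : ET2_sum et_pre;
  et3 : ET3 et_pre;
  et3op : ET3op et_pre;
  et4 : ET4 et_pre;
  et4op : ET4op et_pre }.

Section ExtriangulatedNotions.
Variable B : extricat.
Implicit Types (a b c : B) (X Y U V : B -> Prop).

Definition conflation a b c (x : mor a b) (y : mor b c) : Prop :=
  exists d : ext c a, realizes d x y.

Definition deflation b c (y : mor b c) : Prop :=
  exists a (x : mor a b), conflation x y.

Definition ext_projective p : Prop := forall b (d : ext p b), d = 0.

Definition enough_ext_projectives : Prop :=
  forall b, exists p, ext_projective p /\ exists y : mor p b, deflation y.

Definition Cone X Y : B -> Prop := fun b =>
  exists x y (f : mor x y) (g : mor y b), [/\ X x, Y y & conflation f g].

Definition CoCone X Y : B -> Prop := fun b =>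
  exists x y (f : mor b x) (g : mor x y), [/\ X x, Y y & conflation f g].

Definition star X Y : B -> Prop := fun b =>
  exists x y (f : mor x b) (g : mor b y), [/\ X x, Y y & conflation f g].

Definition lperp X : B -> Prop := fun b => forall x (d : ext b x), X x -> d = 0.

Definition is_cotorsion_pair U V : Prop :=
  [/\ [/\ is_additive_subcat U, summand_closed U & iso_closed U],
      [/\ is_additive_subcat V, summand_closed V & iso_closed V],
      forall u v (d : ext u v), U u -> V v -> d = 0,
      forall b, Cone V U b
    & forall b, CoCone V U b].

Definition kernel U V : B -> Prop := add_closure (star U V).

(* This is also the intersection of U and [lperp U]. *)
Definition coheart U V : B -> Prop := lperp (kernel U V).

Definition Omega X : B -> Prop := CoCone ext_projective X.

End ExtriangulatedNotions.

(* The lemmas on conflations serve only to construct [sigma_plus], [sigma_minus]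
   and [H_functor]. *)

Section Exactness.
Variable B : extricat.
Implicit Types a b c z w : B.

Lemma push0r c a a' (f : mor a a') : push f (0 : ext c a) = 0.
Proof. by apply: (@addrI _ (push f 0)); rewrite -pushDr !addr0. Qed.

Lemma pull0r c c' a (g : mor c' c) : pull g (0 : ext c a) = 0.
Proof. by apply: (@addrI _ (pull g 0)); rewrite -pullDr !addr0. Qed.

Lemma push0l c a a' (d : ext c a) : push (0 : mor a a') d = 0.
Proof. by apply: (@addrI _ (push 0 d)); rewrite -pushDl !addr0. Qed.

Lemma pull0l c c' a (d : ext c a) : pull (0 : mor c' c) d = 0.
Proof. by apply: (@addrI _ (pull 0 d)); rewrite -pullDl !addr0. Qed.

Lemma pushBl c a a' (f f' : mor a a') (d : ext c a) :
  push (f - f') d = push f d - push f' d.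
Proof. by apply: (@addIr _ (push f' d)); rewrite -pushDl !subrK. Qed.

Lemma pullBl c c' a (g g' : mor c' c) (d : ext c a) :
  pull (g - g') d = pull g d - pull g' d.
Proof. by apply: (@addIr _ (pull g' d)); rewrite -pullDl !subrK. Qed.

Lemma realizable c a (d : ext c a) :
  exists b (x : mor a b) (y : mor b c), realizes d x y.
Proof.
have [[b [x y]] hS] := realization_class d; exists b, x, y.
by apply/hS; exists (idm b); split=> /=; rewrite ?cmp1m ?cmpm1 //;
  exists (idm b); rewrite cmp1m.
Qed.

Lemma realizes_id0 a z : is_zero z ->
  realizes (0 : ext z a) (idm a) (0 : mor a z).
Proof.
move=> hz; apply: (et2_split (i2 := 0) (p1 := idm a)).
have e0 : idm z = 0 by case: (hz z).
by split; rewrite ?cmp1m ?cmpm1 ?cmp0m ?cmpm0 ?addr0.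
Qed.

Lemma realizes_0id c z : is_zero z ->
  realizes (0 : ext c z) (0 : mor z c) (idm c).
Proof.
move=> hz; apply: (et2_split (i2 := idm c) (p1 := 0)).
have e0 : idm z = 0 by case: (hz z).
by split; rewrite ?cmp1m ?cmpm1 ?cmp0m ?cmpm0 ?add0r.
Qed.

Section Fixed.
Variables (a b c : B) (d : ext c a) (x : mor a b) (y : mor b c).
Hypothesis r : realizes d x y.

Lemma conf_comp0 : y \oc x = 0.
Proof.
have [z hz] := addcat_zero B.
have [|h [e _]] := et3 (f := idm a) (g := x) (realizes_id0 a hz) r.
  by rewrite cmpm1.
by rewrite -e cmpm0.
Qed.

Lemma conf_push0 : push x d = 0.
Proof.
have [z hz] := addcat_zero B.
have [|h [_ ->]] := et3 (f := x) (g := idm b) r (realizes_id0 b hz).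
  by [].
exact: pull0r.
Qed.

Lemma conf_pull0 : pull y d = 0.
Proof.
have [z hz] := addcat_zero B.
have [|f [_ <-]] := et3op (g := idm b) (h := y) (realizes_0id b hz) r.
  by [].
exact: push0r.
Qed.

Lemma conf_desc w (g : mor b w) : g \oc x = 0 -> exists h, g = h \oc y.
Proof.
move=> e; have [z hz] := addcat_zero B.
have [|h [e' _]] := et3 (f := 0) (g := g) r (realizes_0id w hz).
  by rewrite cmpm0.
by exists h; rewrite e' cmp1m.
Qed.

Lemma conf_lift w (g : mor w b) : y \oc g = 0 -> exists h, g = x \oc h.
Proof.
move=> e; have [z hz] := addcat_zero B.
have [|h [e' _]] := et3op (g := g) (h := 0) (realizes_id0 w hz) r.
  by rewrite cmp0m.
by exists h; rewrite -e' cmpm1.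
Qed.

Lemma conf_ext w (f : mor a w) : push f d = 0 -> exists g, g \oc x = f.
Proof.
move=> e; have [z hz] := addcat_zero B.
have [|g [e' _]] := et2_morphism (f := f) (h := 0) r (realizes_id0 w hz).
  by rewrite e pull0r.
by exists g; rewrite e' cmp1m.
Qed.

Lemma conf_colift w (f : mor w c) : pull f d = 0 -> exists g, y \oc g = f.
Proof.
move=> e; have [z hz] := addcat_zero B.
have [|g [_ e']] := et2_morphism (f := 0) (h := f) (realizes_0id w hz) r.
  by rewrite e push0r.
by exists g; rewrite e' cmpm1.
Qed.

End Fixed.

Section FixedE.
Variables (a b c : B) (d : ext c a) (x : mor a b) (y : mor b c).
Hypothesis r : realizes d x y.

Lemma conf_ext_pull w (t : ext b w) :
  pull x t = 0 -> exists t', t = pull y t'.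
Proof.
move=> e; have [m [i [q rt]]] := realizable t.
have [E [k [l [h [d2 [_ [_ [r1 e2 e3]]]]]]]] := et4op r rt.
have [s es] : exists s, s \oc l = idm w.
  by apply: (conf_ext r1); rewrite e push0r.
exists (push s d2).
by rewrite -push_pull e3 -pushM es push1.
Qed.

Lemma conf_ext_push w (t : ext w b) :
  push y t = 0 -> exists t', t = push x t'.
Proof.
move=> e; have [m [i [q rt]]] := realizable t.
have [E [k [l [h [d2 [_ [_ [r1 e2 e3]]]]]]]] := et4 r rt.
have [s es] : exists s, l \oc s = idm w.
  by apply: (conf_colift r1); rewrite e pull0r.
exists (pull s d2).
by rewrite push_pull e3 -pullM es pull1.
Qed.

End FixedE.

End Exactness.

Section Heart.
Variables (B : extricat) (U V : B -> Prop) (cp : is_cotorsion_pair U V).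
Implicit Types a b c z x : B.

Definition core : B -> Prop := fun b => U b /\ V b.

Definition Bplus : B -> Prop := Cone V core.

Definition Bminus : B -> Prop := CoCone core U.

Definition heart_pred : B -> Prop := fun b => Bplus b /\ Bminus b.

Definition is_reflection b z (p : mor b z) : Prop :=
  [/\ Bplus z,
      exists u (q : mor z u), U u /\ conflation p q
    & forall v, V v -> forall d : ext b v, exists d' : ext z v, pull p d' = d].

Definition is_coreflection b x (m : mor x b) : Prop :=
  [/\ Bminus x,
      exists v (i : mor v x), V v /\ conflation i m
    & forall u, U u -> forall d : ext u b, exists d' : ext u x, push m d' = d].

(* Pairing the object with its morphism lets the normalization be an equality
   without transport. *)
Record reflection_choice := ReflectionChoice {
  refl : forall b, {z : B & mor b z};
  reflP : forall b, is_reflection (projT2 (refl b));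
  refl_id : forall b, Bplus b -> refl b = existT _ b (idm b) }.

Record coreflection_choice := CoreflectionChoice {
  corefl : forall b, {x : B & mor x b};
  coreflP : forall b, is_coreflection (projT2 (corefl b));
  corefl_id : forall b, Bminus b -> corefl b = existT _ b (idm b) }.

Lemma core_additive : is_additive_subcat core.
Proof.
case: cp => [[[[z [hz Uz]] Ubp] _ _] [[[z' [hz' Vz']] Vbp] _ Viso] _ _ _].
split.
  exists z; do 2!split=> //; apply: Viso Vz'.
  exists 0; exists 0; rewrite !cmp0m.
  by split; [case: (hz' z') => /(_ (idm z')) | case: (hz z) => /(_ (idm z))].
move=> a b s i1 i2 p1 p2 bp [Ua Va] [Ub Vb].
by split; [apply: Ubp bp _ _ | apply: Vbp bp _ _].
Qed.

Definition stable_cat : preaddcat := quot_cat core_additive.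

Definition stable_pi : functor B stable_cat := quot_functor core_additive.

(* The core lies in B^+, B^- and in their intersection, so factoring through the
   core means the same inside these subcategories: B^+/W, B^-/W and H/W are the
   full subcategories of B/W on the same objects. *)
Definition stable_plus : preaddcat := @full_sub stable_cat Bplus.

Definition stable_minus : preaddcat := @full_sub stable_cat Bminus.

Definition heart : preaddcat := @full_sub stable_cat heart_pred.

Lemma stable_piP a b (f g : mor a b) :
  fmap stable_pi f = fmap stable_pi g <-> factors core (f - g).
Proof. exact: quot_piP. Qed.

Lemma stable_piM a b c (g : mor b c) (f : mor a b) :
  @cmp stable_cat a b c (fmap stable_pi g) (fmap stable_pi f) =
  fmap stable_pi (g \oc f).
Proof. exact: quot_cmpE. Qed.

Lemma stable_pi_surj a b (f : @mor stable_cat a b) :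
  exists g : mor a b, f = fmap stable_pi g.
Proof. by exists (repr f); rewrite /= quot_piK. Qed.

Lemma ext_UV u v (d : ext u v) : U u -> V v -> d = 0.
Proof. by case: cp => _ _ + _ _; apply. Qed.

Lemma is_summand_of_section a b (s : mor a b) c (q : mor b c)
    (d : ext c a) (t : mor b a) :
  realizes d s q -> t \oc s = idm a -> is_summand a b.
Proof.
move=> r ets.
have [k ek] : exists k, idm b - s \oc t = k \oc q.
  by apply: (conf_desc r); rewrite cmpBl cmp1m -cmpA ets cmpm1 subrr.
have d0 : d = 0 by rewrite -[d]push1 -ets pushM (conf_push0 r) push0r.
have [l el] : exists l, q \oc l = idm c.
  by apply: (conf_colift r); rewrite d0 pull0r.
have eqk : q \oc k = idm c.
  have : q \oc k \oc q = q.
    by rewrite -cmpA -ek cmpBr cmpm1 cmpA (conf_comp0 r) cmp0m subr0.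
  by move=> /(congr1 (fun f => f \oc l)); rewrite -cmpA el cmpm1.
exists c, s, k, t, q; split=> //; last by rewrite -ek addrC subrK.
- have : t \oc k \oc q = 0 by rewrite -cmpA -ek cmpBr cmpm1 cmpA ets cmp1m subrr.
  move=> /(congr1 (fun f => f \oc l)).
  by rewrite -cmpA el cmpm1 cmp0m.
- exact: conf_comp0 r.
Qed.

Lemma V_perp b : (forall u (d : ext u b), U u -> d = 0) -> V b.
Proof.
move=> h; case: cp => _ [_ Vs _] _ _ /(_ b)[v [u [s [q [Vv Uu [d r]]]]]].
have [t et] : exists t, t \oc s = idm b.
  by apply: (conf_ext r); rewrite (h _ d Uu) push0r.
exact: Vs (is_summand_of_section r et) Vv.
Qed.

Lemma reflection_inj b z (p : mor b z) y (g : mor z y) :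
  is_reflection p -> Bplus y -> factors core (g \oc p) -> factors core g.
Proof.
case=> [_ [u [q [Uu [e re]]]] _] [v [w [i [r [Vv Ww [d rd]]]]]].
case=> w' [[Uw' Vw'] [h [k eg]]].
have [h' eh] : exists h', h' \oc p = h.
  by apply: (conf_ext re); exact: ext_UV.
have [l el] : exists l, g - k \oc h' = l \oc q.
  by apply: (conf_desc re); rewrite cmpBl eg -cmpA eh subrr.
have [l' el'] : exists l', r \oc l' = l.
  by apply: (conf_colift rd); exact: ext_UV.
rewrite -[g](subrK (k \oc h')) el -el' -cmpA.
rewrite -[X in _ + X]opprK.
apply/(factor_predP core_additive)/rpredB; apply/factor_predP.
  by exists w; split=> //; exists (l' \oc q), r.
exists w'; split=> //; exists h', (- k); by rewrite cmpNm.
Qed.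

Lemma reflection_universal b z (p : mor b z) y (f : @mor stable_cat b y) :
  is_reflection p -> Bplus y ->
  exists! g : @mor stable_cat z y, g \oc fmap stable_pi p = f.
Proof.
move=> hp hy; have [f0 ->] := stable_pi_surj f.
have [g eg] : exists g, factors core (g \oc p - f0).
  case: (hp) => [_ [u [q [Uu [e re]]]] sur].
  case: (hy) => [v [w [i [r [Vv [Uw Vw] [d rd]]]]]].
  have [t et] := sur v Vv (pull f0 d).
  have [m [j [k rt]]] := realizable t.
  have it0 : push i t = 0.
    have [t' ->] : exists t', push i t = pull q t'.
      apply: (conf_ext_pull re).
      by rewrite -push_pull et push_pull (conf_push0 rd) pull0r.
    by rewrite (ext_UV t' Uu Vw) pull0r.
  have [l el] : exists l, l \oc j = i by apply: (conf_ext rt).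
  have [|g [_ eg]] := et3 (f := idm v) (g := l) rt rd; first by rewrite cmpm1.
  rewrite push1 in eg.
  have [h eh] : exists h, r \oc h = g \oc p - f0.
    by apply: (conf_colift rd); rewrite pullBl pullM -eg et subrr.
  by exists g, w; split=> //; exists h, r.
exists (fmap stable_pi g); split.
  by rewrite stable_piM; apply/stable_piP.
move=> g'; have [g0 ->] := stable_pi_surj g'.
move: eg => /stable_piP <-; rewrite stable_piM => /esym/stable_piP.
rewrite -cmpBl => hf; apply/stable_piP; exact: reflection_inj hp hy hf.
Qed.

Lemma coreflection_inj b x (m : mor x b) y (g : mor y x) :
  is_coreflection m -> Bminus y -> factors core (m \oc g) -> factors core g.
Proof.
case=> [_ [v [i [Vv [e re]]]] _] [w [u [r [q [Ww Uu [d rd]]]]]].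
case=> w' [[Uw' Vw'] [h [k eg]]].
have [k' ek] : exists k', m \oc k' = k.
  by apply: (conf_colift re); exact: ext_UV.
have [l el] : exists l, g - k' \oc h = i \oc l.
  by apply: (conf_lift re); rewrite cmpBr eg cmpA ek subrr.
have [l' el'] : exists l', l' \oc r = l.
  by apply: (conf_ext rd); exact: ext_UV.
rewrite -[g](subrK (k' \oc h)) el -el' cmpA.
rewrite -[X in _ + X]opprK.
apply/(factor_predP core_additive)/rpredB; apply/factor_predP.
  by exists w; split=> //; exists r, (i \oc l').
exists w'; split=> //; exists h, (- k'); by rewrite cmpNm.
Qed.

Lemma coreflection_universal b x (m : mor x b) y (f : @mor stable_cat y b) :
  is_coreflection m -> Bminus y ->
  exists! g : @mor stable_cat y x, fmap stable_pi m \oc g = f.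
Proof.
move=> hm hy; have [f0 ->] := stable_pi_surj f.
have [g eg] : exists g, factors core (m \oc g - f0).
  case: (hm) => [_ [v [i [Vv [e re]]]] sur].
  case: (hy) => [w [u [r [q [[Uw Vw] Uu [d rd]]]]]].
  have [t et] := sur u Uu (push f0 d).
  have [n [j [k rt]]] := realizable t.
  have qt0 : pull q t = 0.
    have [t' ->] : exists t', pull q t = push i t'.
      apply: (conf_ext_push re).
      by rewrite push_pull et -push_pull (conf_pull0 rd) push0r.
    by rewrite (ext_UV t' Uw Vv) push0r.
  have [l el] : exists l, k \oc l = q by apply: (conf_colift rt).
  have [|g [_ eg]] := et3op (g := l) (h := idm u) rd rt; first by rewrite cmp1m.
  rewrite pull1 in eg.
  have [h eh] : exists h, h \oc r = m \oc g - f0.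
    by apply: (conf_ext rd); rewrite pushBl pushM eg et subrr.
  by exists g, w; split=> //; exists r, h.
exists (fmap stable_pi g); split.
  by rewrite stable_piM; apply/stable_piP.
move=> g'; have [g0 ->] := stable_pi_surj g'.
move: eg => /stable_piP <-; rewrite stable_piM => /esym/stable_piP.
rewrite -cmpBr => hf; apply/stable_piP; exact: coreflection_inj hm hy hf.
Qed.

Lemma coreflection_Bplus b x (m : mor x b) :
  is_coreflection m -> Bplus b -> Bplus x.
Proof.
case=> [_ [v [i [Vv [e re]]]] _] [v0 [w [j [r [Vv0 [Uw Vw] [d rd]]]]]].
have [y [k [l rt]]] := realizable (pull m d).
have Vy : V y.
  apply: V_perp => u t Uu.
  have [s [_ es]] : exists s, s \oc k = j \oc idm v0 /\ r \oc s = m \oc l.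
    by apply: (et2_morphism rt rd); rewrite push1.
  have lt0 : push l t = 0.
    have [t1 e1] : exists t1, push l t = push i t1.
      apply: (conf_ext_push re).
      by rewrite -pushM -es pushM (ext_UV (push s t) Uu Vw) push0r.
    by rewrite e1 (ext_UV t1 Uu Vv) push0r.
  have [t1 ->] := conf_ext_push rt lt0.
  by rewrite (ext_UV t1 Uu Vv0) push0r.
have [v1 [u1 [a1 [b1 [Vv1 Uu1 [d1 r1]]]]]] : Cone V U y by case: cp.
have Vu1 : V u1.
  apply: V_perp => u t Uu.
  have [t1 ->] : exists t1, t = push a1 t1.
    by apply: (conf_ext_push r1); exact: ext_UV.
  by rewrite (ext_UV t1 Uu Vv1) push0r.
have [E [c1 [c2 [h [d2 [_ [r2 [r3 _ _]]]]]]]] := et4op rt r1.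
exists E, u1, h, (l \oc b1); split=> //; last by exists d2.
apply: V_perp => u t Uu.
have [t1 ->] : exists t1, t = push c2 t1.
  by apply: (conf_ext_push r3); exact: ext_UV.
by rewrite (ext_UV t1 Uu Vv1) push0r.
Qed.

Section HFunctor.
Variables (rc : reflection_choice) (cc : coreflection_choice).

Definition sigma_plus_obj (b : stable_cat) : stable_plus :=
  exist _ (projT1 (refl rc b))
    (let: And3 h _ _ := reflP rc b in h).

Definition sigma_plus_map (b c : stable_cat) (f : @mor stable_cat b c) :
    @mor stable_plus (sigma_plus_obj b) (sigma_plus_obj c) :=
  sval (cid (reflection_universal
    (fmap stable_pi (projT2 (refl rc c)) \oc f)
    (reflP rc b) (svalP (sigma_plus_obj c)))).

Lemma sigma_plus_mapP (b c : stable_cat) (f : @mor stable_cat b c) :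
  (sigma_plus_map f : @mor stable_cat _ _) \oc
    fmap stable_pi (projT2 (refl rc b)) =
  fmap stable_pi (projT2 (refl rc c)) \oc f.
Proof. by rewrite /sigma_plus_map; case: cid => g []. Qed.

Lemma sigma_plus_map_uniq (b c : stable_cat) (f : @mor stable_cat b c)
    (g : @mor stable_cat (projT1 (refl rc b)) (projT1 (refl rc c))) :
  g \oc fmap stable_pi (projT2 (refl rc b)) =
    fmap stable_pi (projT2 (refl rc c)) \oc f ->
  sigma_plus_map f = g.
Proof. by rewrite /sigma_plus_map; case: cid => g' [_ /=]; apply. Qed.

Definition sigma_plus : functor stable_cat stable_plus.
Proof.
exists sigma_plus_obj sigma_plus_map.
- by move=> b; apply: sigma_plus_map_uniq; rewrite cmp1m cmpm1.
- move=> a b c g f; apply: sigma_plus_map_uniq.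
  by rewrite -cmpA sigma_plus_mapP cmpA sigma_plus_mapP cmpA.
Defined.

Definition sigma_minus_obj (b : stable_cat) : stable_minus :=
  exist _ (projT1 (corefl cc b))
    (let: And3 h _ _ := coreflP cc b in h).

Definition sigma_minus_map (b c : stable_cat) (f : @mor stable_cat b c) :
    @mor stable_minus (sigma_minus_obj b) (sigma_minus_obj c) :=
  sval (cid (coreflection_universal
    (f \oc fmap stable_pi (projT2 (corefl cc b)))
    (coreflP cc c) (svalP (sigma_minus_obj b)))).

Lemma sigma_minus_mapP (b c : stable_cat) (f : @mor stable_cat b c) :
  fmap stable_pi (projT2 (corefl cc c)) \oc
    (sigma_minus_map f : @mor stable_cat _ _) =
  f \oc fmap stable_pi (projT2 (corefl cc b)).
Proof. by rewrite /sigma_minus_map; case: cid => g []. Qed.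

Lemma sigma_minus_map_uniq (b c : stable_cat) (f : @mor stable_cat b c)
    (g : @mor stable_cat (projT1 (corefl cc b)) (projT1 (corefl cc c))) :
  fmap stable_pi (projT2 (corefl cc c)) \oc g =
    f \oc fmap stable_pi (projT2 (corefl cc b)) ->
  sigma_minus_map f = g.
Proof. by rewrite /sigma_minus_map; case: cid => g' [_ /=]; apply. Qed.

Definition sigma_minus : functor stable_cat stable_minus.
Proof.
exists sigma_minus_obj sigma_minus_map.
- by move=> b; apply: sigma_minus_map_uniq; rewrite cmp1m cmpm1.
- move=> a b c g f; apply: sigma_minus_map_uniq.
  rewrite -(cmpA g f) -(sigma_minus_mapP f) (cmpA g).
  transitivity (fmap stable_pi (projT2 (corefl cc c)) \oc
    (sigma_minus_map g : @mor stable_cat _ _) \oc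
    (sigma_minus_map f : @mor stable_cat _ _)); first exact: cmpA.
  by rewrite (sigma_minus_mapP g).
Defined.

(* [coreflection_Bplus] makes this composite land in the heart. *)
Definition sigma : functor B stable_minus :=
  fcomp sigma_minus (fcomp (@incl stable_cat Bplus) (fcomp sigma_plus stable_pi)).

Lemma sigma_heart b : heart_pred (sval (sigma b)).
Proof.
split; last exact: svalP.
exact: coreflection_Bplus (coreflP cc _) (svalP (sigma_plus_obj b)).
Qed.

Definition H_functor : functor B heart := corestrict sigma_heart.

End HFunctor.

End Heart.

(* Main.v *)
Require Import Defs.
From mathcomp Require Import all_boot all_algebra.

(** All arguments take place in the ambient category; a morphism is called null
    when it factors through the core W, and the heart is the category of heart
    objects modulo null morphisms.  B^- consists of the objects whose morphisms
    to V are all null, B^+ of those receiving only null morphisms from U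
    ([BminusP], [BplusP]).  On B^- the functor H is the reflection b -> b^+.

    Let a >-> p ->> c be a conflation with [p] projective and [c] in the coheart
    C, and let [e] be its class.  Then [a] is in B^-, and f |-> f_* e identifies
    the stable morphisms from [a] (hence the morphisms from H a) to a heart
    object z with E(c, z) ([syzygy_class], [syzygy_null], [null_push_coheart]).  As
    E(C, U) = 0, it pays to recognize extensions whose middle term lies in U,
    and [U_of_null_into_heart] does so inside the heart: if y >-> x ->> u with
    [y] in B^- and [u] in U, and if every composite of [y] -> [x] with a map from
    [x] to a heart object is null, then [x] is in U.

    - H a is projective: pushing the class of x >-> w ->> u ([w] in the core)
      out along an epimorphism x -> y of the heart gives a middle term in U, so
      that E(c, x) -> E(c, y) is onto ([syzygy_projective]).
    - cond1 implies cond4: for y >-> p ->> u with [u] in U and [p] projective, an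
      epimorphism from some H a onto the reflection of [y] is a class that lifts
      to E(c, y), and the extension y >-> x ->> c it defines has [x] in U
      ([Bminus_CoCone_coheart]).  The push-out x >-> e ->> u of the two
      conflations has [e] in C, because [e] is an extension of [c] by [p].
    - cond4 implies cond2: conflations k >-> c ->> u are composed with
      v >-> u ->> b and pulled back along v -> u in b >-> v ->> u; the new left
      terms stay in the kernel K by [kernel_ext_V].  One of the defining
      conditions of cond2 is cond3.
    - cond3 implies cond1: the class of b >-> k ->> c is f_* e for some f : a -> b.
      A map from [b] to the heart that kills [f] extends to [k], and maps from
      B^- to B^+ through the kernel are null ([null_through_kernel]).

    Under cond1 every projective object x of the heart splits off some H a in the
    weak sense of being a retract.  It then has a complement because the
    section, once an inflation of x into the core is added to it, becomes an
    inflation with a retraction ([heart_summand]). *)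

Set Implicit Arguments.
Unset Strict Implicit.
Unset Printing Implicit Defensive.

Import GRing.Theory.
Local Open Scope ring_scope.

(** * Biproducts and summands *)

Section Biproducts.
Variable C : preaddcat.
Implicit Types a b c s t u : C.

Lemma cmp_idK a b c (g : mor b a) (f : mor a b) (h : mor c a) :
  g \oc f = idm a -> g \oc (f \oc h) = h.
Proof. by move=> e; rewrite cmpA e cmp1m. Qed.

Lemma cmp_0K a b c u (g : mor b u) (f : mor a b) (h : mor c a) :
  g \oc f = 0 -> g \oc (f \oc h) = 0.
Proof. by move=> e; rewrite cmpA e cmp0m. Qed.

Lemma is_biprod_sym a b s (i1 : mor a s) (i2 : mor b s) (p1 : mor s a)
    (p2 : mor s b) :
  is_biprod i1 i2 p1 p2 -> is_biprod i2 i1 p2 p1.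
Proof. by case=> *; split=> //; rewrite addrC. Qed.

Lemma is_biprod0 a z : is_zero z ->
  is_biprod (idm a) (0 : mor z a) (idm a) (0 : mor a z).
Proof.
move=> hz; have e0 : idm z = 0 by case: (hz z).
by split; rewrite ?cmp1m ?cmpm1 ?cmp0m ?cmpm0 ?addr0.
Qed.

(** The four products of injections and projections, each also in the form
    needed when a further morphism stands to the right. *)
Lemma is_biprodE a b s (i1 : mor a s) (i2 : mor b s) (p1 : mor s a)
    (p2 : mor s b) : is_biprod i1 i2 p1 p2 ->
  ((p1 \oc i1 = idm a) * (p2 \oc i2 = idm b) * (p1 \oc i2 = 0) *
   (p2 \oc i1 = 0)) *
  ((forall c (h : mor c a), p1 \oc (i1 \oc h) = h) *
   (forall c (h : mor c b), p2 \oc (i2 \oc h) = h) *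
   (forall c (h : mor c b), p1 \oc (i2 \oc h) = 0) *
   (forall c (h : mor c a), p2 \oc (i1 \oc h) = 0)).
Proof.
by case=> e1 e2 e3 e4 _; do !split=> // *; rewrite ?(cmp_idK _ e1)
  ?(cmp_idK _ e2) ?(cmp_0K _ e3) ?(cmp_0K _ e4).
Qed.

Lemma is_biprod_sum a b s (i1 : mor a s) (i2 : mor b s) (p1 : mor s a)
    (p2 : mor s b) : is_biprod i1 i2 p1 p2 ->
  forall c (h : mor c s), i1 \oc (p1 \oc h) + i2 \oc (p2 \oc h) = h.
Proof. by case=> _ _ _ _ e c h; rewrite !cmpA -cmpDl e cmp1m. Qed.

End Biproducts.

Local Ltac biprod_simpl E :=
  rewrite ?(cmpDl, cmpDr) -?cmpA ?E
    ?(cmp1m, cmpm1, cmp0m, cmpm0, addr0, add0r).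

Section Summands.
Variable C : addcat.
Implicit Types (a b c s t : C) (X : C -> Prop).

Lemma is_summand_refl a : is_summand a a.
Proof.
have [z hz] := addcat_zero C.
by exists z, (idm a), 0, (idm a), 0; exact: is_biprod0.
Qed.

Lemma is_summand_trans s a t :
  is_summand a s -> is_summand s t -> is_summand a t.
Proof.
case=> b [i1 [i2 [p1 [p2 H]]]] [c [j1 [j2 [q1 [q2 K]]]]].
have [e [k1 [k2 [r1 [r2 L]]]]] := addcat_biprod b c.
have E := (is_biprodE H, is_biprodE K, is_biprodE L).
exists e, (j1 \oc i1), (j1 \oc i2 \oc r1 + j2 \oc r2), (p1 \oc q1),
  (k1 \oc p2 \oc q1 + k2 \oc q2).
split; do 2!biprod_simpl E => //; first by case: L.
by rewrite addrA -cmpDr (is_biprod_sum H); case: K.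
Qed.

Lemma is_summand_biprodl a a' b s s' (i1 : mor a s) (i2 : mor b s)
    (p1 : mor s a) (p2 : mor s b) (j1 : mor a' s') (j2 : mor b s')
    (q1 : mor s' a') (q2 : mor s' b) :
  is_biprod i1 i2 p1 p2 -> is_biprod j1 j2 q1 q2 ->
  is_summand a a' -> is_summand s s'.
Proof.
move=> H K [c [k1 [k2 [r1 [r2 L]]]]].
have E := (is_biprodE H, is_biprodE K, is_biprodE L).
exists c, (j1 \oc k1 \oc p1 + j2 \oc p2), (j1 \oc k2),
  (i1 \oc r1 \oc q1 + i2 \oc q2), (r2 \oc q1).
split; do 2!biprod_simpl E => //; first by case: H.
by rewrite addrAC -cmpDr (is_biprod_sum L); case: K.
Qed.

Lemma is_summand_biprod a a' b b' s s' (i1 : mor a s) (i2 : mor b s)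
    (p1 : mor s a) (p2 : mor s b) (j1 : mor a' s') (j2 : mor b' s')
    (q1 : mor s' a') (q2 : mor s' b') :
  is_biprod i1 i2 p1 p2 -> is_biprod j1 j2 q1 q2 ->
  is_summand a a' -> is_summand b b' -> is_summand s s'.
Proof.
move=> H K ha hb; have [m [k1 [k2 [r1 [r2 L]]]]] := addcat_biprod a' b.
apply: is_summand_trans (is_summand_biprodl H L ha) _.
exact: is_summand_biprodl (is_biprod_sym L) (is_biprod_sym K) hb.
Qed.

Lemma is_summand_iso a b : isomorphic a b -> is_summand a b.
Proof.
case=> f [g [egf efg]]; have [z hz] := addcat_zero C.
exists z, f, 0, g, 0; have e0 : idm z = 0 by case: (hz z).
by split; rewrite ?cmp0m ?cmpm0 ?addr0.
Qed.

Lemma add_closure_sub X a : X a -> add_closure X a.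
Proof. by exists a; split=> //; exact: is_summand_refl. Qed.

Lemma add_closure_summand X : summand_closed (add_closure X).
Proof.
by move=> a s h [t [Xt ht]]; exists t; split=> //; exact: is_summand_trans h ht.
Qed.

Lemma add_closure_iso X : iso_closed (add_closure X).
Proof.
move=> a b [f [g [egf efg]]]; apply: add_closure_summand.
by apply: is_summand_iso; exists g, f.
Qed.

End Summands.

(** * Exact sequences and squares of conflations *)

Section Conflations.
Variable B : extricat.
Implicit Types (a b c w z : B) (X : B -> Prop).

Lemma conf_idr a z : is_zero z -> conflation (idm a) (0 : mor a z).
Proof. by move=> hz; exists 0; exact: realizes_id0. Qed.

Lemma realizes_iso a b b' c (d : ext c a) (x : mor a b) (y : mor b c)
    (x' : mor a b') (y' : mor b' c) :
  realizes d x y -> realizes d x' y' -> isomorphic b b'.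
Proof.
have [S hS] := realization_class d => /hS[f [[g [egf efg]] _ _]].
move=> /hS[f' [[g' [egf' efg']] _ _]].
exists (f' \oc g), (f \oc g'); split.
  by rewrite -cmpA (cmp_idK _ egf') efg.
by rewrite -cmpA (cmp_idK _ egf) efg'.
Qed.

(** Exactness of B(w, c) -> E(w, a) -> E(w, b): a realization of the class
    killed by [x] receives a morphism from [b], and (ET3) completes it. *)
Lemma conf_push_ker a b c (d : ext c a) (x : mor a b) (y : mor b c) w
    (t : ext w a) :
  realizes d x y -> push x t = 0 -> exists h : mor w c, t = pull h d.
Proof.
move=> r e; have [m [i [q rt]]] := realizable t.
have [g eg] := conf_ext rt e.
have [|h [_]] := et3 (f := idm a) (g := g) rt r; first by rewrite cmpm1.
by rewrite push1; exists h.
Qed.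

Lemma conf_pull_ker a b c (d : ext c a) (x : mor a b) (y : mor b c) w
    (t : ext c w) :
  realizes d x y -> pull y t = 0 -> exists h : mor a w, t = push h d.
Proof.
move=> r e; have [m [i [q rt]]] := realizable t.
have [g eg] := conf_colift rt e.
have [|h [_]] := et3op (g := g) (h := idm c) r rt; first by rewrite cmp1m.
by rewrite pull1 => <-; exists h.
Qed.

(** Idempotents need not split, but [y] is a weak cokernel of [x]: the
    projection 1 - x t factors through it, which provides the section. *)
Lemma biprod_of_retraction a b c (d : ext c a) (x : mor a b) (y : mor b c)
    (t : mor b a) : realizes d x y -> t \oc x = idm a ->
  exists s : mor c b, is_biprod x s t y.
Proof.
move=> r et.
have [s es] : exists s, idm b - x \oc t = s \oc y.
  by apply: (conf_desc r); rewrite cmpBl cmp1m -cmpA et cmpm1 subrr.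
have d0 : d = 0 by rewrite -[d]push1 -et pushM (conf_push0 r) push0r.
have [l el] : exists l, y \oc l = idm c.
  by apply: (conf_colift r); rewrite d0 pull0r.
have es' : s = l - x \oc (t \oc l).
  by rewrite -[s]cmpm1 -el cmpA -es cmpBl cmp1m -cmpA.
exists s; split=> //.
- by rewrite es' cmpBr el (cmp_0K _ (conf_comp0 r)) subr0.
- by rewrite es' cmpBr (cmp_idK _ et) subrr.
- exact: conf_comp0 r.
- by rewrite -es addrC subrK.
Qed.

Lemma biprod_of_section a b c (d : ext c a) (x : mor a b) (y : mor b c)
    (s : mor c b) : realizes d x y -> y \oc s = idm c ->
  exists t : mor b a, is_biprod x s t y.
Proof.
move=> r es.
have d0 : d = 0 by rewrite -[d]pull1 -es pullM (conf_pull0 r) pull0r.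
have [t0 et0] : exists t, t \oc x = idm a.
  by apply: (conf_ext r); rewrite d0 push0r.
have [s0 [_ _ _ _ e1]] := biprod_of_retraction r et0.
have yx := conf_comp0 r.
have es0 : s = x \oc (t0 \oc s) + s0.
  by rewrite -[LHS]cmp1m -e1 cmpDl -!cmpA es cmpm1.
exists (t0 - t0 \oc s \oc y); split=> //.
- by rewrite cmpBl et0 -cmpA yx cmpm0 subr0.
- by rewrite cmpBl -cmpA es cmpm1 subrr.
- by rewrite -e1 cmpBr !cmpA {2}es0 cmpDl !cmpA addrA subrK.
Qed.

(** The push-out square of two inflations out of [a].  (ET4) gives a conflation
    a >-> e ->> f with f an extension of c' by c which splits; correcting the
    section so that it pulls the class of a >-> e ->> f back to [d'] exhibits
    the kernel of e ->> f ->> c as a realization of [d']. *)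
Lemma conf_pushout a b c b' c' (d : ext c a) (d' : ext c' a) (x : mor a b)
    (y : mor b c) (x' : mor a b') (y' : mor b' c') :
  realizes d x y -> realizes d' x' y' ->
  exists e (m : mor b e) (n : mor e c'), realizes (push x d') m n /\
  exists b2 (m' : mor b2 e) (n' : mor e c), isomorphic b' b2 /\
    conflation m' n'.
Proof.
move=> r r'; have [e [m [n rn]]] := realizable (push x d').
exists e, m, n; split=> //.
have [f [u [v [h [dl [_ [rh [rf edl exl]]]]]]]] := et4 r rn.
have [s es] : exists s, v \oc s = idm c'.
  apply: (conf_colift rf).
  by rewrite pull1 -pushM (conf_comp0 r) push0l.
have [k ek] : exists k : mor c' c, pull s dl - d' = pull k d.
  apply: (conf_push_ker r); rewrite -[- d']pull1.
  apply: (@addIr _ (push x d')); rewrite add0r -pushDr pull1 subrK.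
  by rewrite push_pull exl -pullM es pull1.
pose s' := s - u \oc k.
have es' : v \oc s' = idm c'.
  by rewrite cmpBr es (cmp_0K _ (conf_comp0 rf)) subr0.
have edl' : pull s' dl = d'.
  by rewrite pullBl pullM edl -ek opprB addrC subrK.
have [p bp] := biprod_of_section rf es'.
have rs := et2_split (is_biprod_sym bp).
have [b2 [q [i [m' [dl2 [_ [rm' [ri _ _]]]]]]]] := et4op rs rh.
rewrite edl' in ri.
exists b2, m', (p \oc h); split; last by exists dl2.
exact: realizes_iso r' ri.
Qed.

(** The pull-back square of two deflations onto [c], dually. *)
Lemma conf_pullback a b c a' b' (d : ext c a) (d' : ext c a') (x : mor a b)
    (y : mor b c) (x' : mor a' b') (y' : mor b' c) :
  realizes d x y -> realizes d' x' y' ->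
  exists e (m : mor a' e) (n : mor e b), realizes (pull y d') m n /\
  exists b2 (m' : mor a e) (n' : mor e b2), isomorphic b' b2 /\
    conflation m' n'.
Proof.
move=> r r'; have [e [m [n rn]]] := realizable (pull y d').
exists e, m, n; split=> //.
have [f [u [v [h [dl [_ [rh [rf edl exl]]]]]]]] := et4op r rn.
have [s es] : exists s, s \oc v = idm a'.
  apply: (conf_ext rf).
  by rewrite push1 -pullM (conf_comp0 r) pull0l.
have [k ek] : exists k : mor a a', push s dl - d' = push k d.
  apply: (conf_pull_ker r); rewrite -[- d']push1.
  apply: (@addIr _ (pull y d')); rewrite add0r -pullDr push1 subrK.
  by rewrite -push_pull exl -pushM es push1.
pose s' := s - k \oc u.
have es' : s' \oc v = idm a'.
  by rewrite cmpBl es -cmpA (conf_comp0 rf) cmpm0 subr0.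
have edl' : push s' dl = d'.
  by rewrite pushBl pushM edl -ek opprB addrC subrK.
have [p bp] := biprod_of_retraction rf es'.
have rs := et2_split (is_biprod_sym bp).
have [b2 [q [i [m' [dl2 [_ [rm' [ri _ _]]]]]]]] := et4 rs rh.
rewrite edl' in ri.
exists b2, (h \oc p), m'; split; last by exists dl2.
exact: realizes_iso r' ri.
Qed.

(** If [x] is an inflation then so is (s, x): it is the split inflation (s, 1)
    followed by the direct sum of [x] with an identity. *)
Lemma inflation_biprod a b c w S (d : ext c a) (x : mor a b) (y : mor b c)
    (s : mor a w) (i1 : mor w S) (i2 : mor b S) (p1 : mor S w) (p2 : mor S b) :
  realizes d x y -> is_biprod i1 i2 p1 p2 ->
  exists e (q : mor S e), conflation (i1 \oc s + i2 \oc x) q.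
Proof.
move=> r H; have [z hz] := addcat_zero B.
have [t [j1 [j2 [q1 [q2 K]]]]] := addcat_biprod w a.
have E := (is_biprodE H, is_biprodE K).
have shear : is_biprod (j1 \oc s + j2) j1 q2 (q1 - s \oc q2).
  split; rewrite ?cmpBl ?cmpBr; do 2!biprod_simpl E; rewrite ?subr0 ?subrr //.
  by rewrite addrC addrA subrK; case: K.
have r0 := et2_split shear.
have r1 := et2_sum K H (is_biprod_sym (is_biprod0 c hz)) (realizes_id0 w hz) r.
have [e [u [v [h [dl [_ [rh _]]]]]]] := et4 r0 r1.
exists e, h, dl; move: rh; congr (realizes _ _ _).
by do 2!biprod_simpl E.
Qed.

Section Perp.
Variable X : B -> Prop.

Lemma lperp_ext a b c (d : ext c a) (x : mor a b) (y : mor b c) :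
  realizes d x y -> lperp X a -> lperp X c -> lperp X b.
Proof.
move=> r ha hc z t Xz.
have [t' ->] : exists t', t = pull y t'.
  by apply: (conf_ext_pull r); exact: ha.
by rewrite (hc z t' Xz) pull0r.
Qed.

Lemma lperp_retract a b (s : mor a b) (p : mor b a) :
  p \oc s = idm a -> lperp X b -> lperp X a.
Proof.
move=> e hb z t Xz.
by rewrite -[t]pull1 -e pullM [pull p t](hb z) // pull0r.
Qed.

Lemma lperp_summand : summand_closed (lperp X).
Proof.
by move=> a s [b [i1 [i2 [p1 [p2 [e _ _ _ _]]]]]]; exact: lperp_retract e.
Qed.

Lemma lperp_iso : iso_closed (lperp X).
Proof. by move=> a b [f [g [_ e]]]; exact: lperp_retract e. Qed.

Lemma lperp_additive : is_additive_subcat (lperp X).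
Proof.
split=> [|a b s i1 i2 p1 p2 [_ _ _ _ e] ha hb w t Xw].
  have [z hz] := addcat_zero B; exists z; split=> // w t _.
  have e0 : idm z = 0 by case: (hz z).
  by rewrite -[t]pull1 e0 pull0l.
rewrite -[t]pull1 -e pullDl !pullM.
by rewrite [pull i1 t](ha w) // [pull i2 t](hb w) // !pull0r addr0.
Qed.

End Perp.

End Conflations.

(** * The kernel of a cotorsion pair *)

Section CotorsionPair.
Variables (B : extricat) (U V : B -> Prop) (cp : is_cotorsion_pair U V).
Implicit Types (a b c u v w x y z : B).

Local Notation W := (core U V).
Local Notation K := (kernel U V).
Local Notation C := (coheart U V).
Local Notation null := (factors W).

Lemma U_perp b : lperp V b -> U b.
Proof.
move=> h; case: cp => [[_ Us _] _ _ /(_ b)[v [u [i [q [Vv Uu [d r]]]]]] _].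
have [s es] : exists s, q \oc s = idm b.
  by apply: (conf_colift r); rewrite pull1; exact: h.
have [t bp] := biprod_of_section r es.
by apply: Us Uu; exists v, s, i, q, t; exact: is_biprod_sym.
Qed.

Lemma lperp_U u : U u -> lperp V u.
Proof. by move=> Uu v d Vv; exact: (ext_UV cp). Qed.

Lemma U_ext a b c (x : mor a b) (y : mor b c) :
  conflation x y -> U a -> U c -> U b.
Proof.
by case=> d r Ua Uc; apply: U_perp; apply: (lperp_ext r); exact: lperp_U.
Qed.

Lemma V_ext a b c (x : mor a b) (y : mor b c) :
  conflation x y -> V a -> V c -> V b.
Proof.
case=> d r Va Vc; apply: (V_perp cp) => u t Uu.
have [t' ->] : exists t', t = push x t'.
  by apply: (conf_ext_push r); exact: (ext_UV cp).
by rewrite (ext_UV cp t' Uu Va) push0r.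
Qed.

Lemma U_zero z : is_zero z -> U z.
Proof.
move=> hz; apply: U_perp => v d _; have e0 : idm z = 0 by case: (hz z).
by rewrite -[d]pull1 e0 pull0l.
Qed.

Lemma V_zero z : is_zero z -> V z.
Proof.
move=> hz; apply: (V_perp cp) => u d _; have e0 : idm z = 0 by case: (hz z).
by rewrite -[d]push1 e0 push0l.
Qed.

Lemma projective_U p : ext_projective p -> U p.
Proof. by move=> hp; apply: U_perp => v d _; exact: hp. Qed.

Lemma star_U u : U u -> star U V u.
Proof.
move=> Uu; have [z hz] := addcat_zero B.
by exists u, z, (idm u), 0; split=> //; [exact: V_zero | exact: conf_idr].
Qed.

Lemma U_kernel u : U u -> K u.
Proof. by move=> /star_U; exact: add_closure_sub. Qed.

Lemma V_kernel v : V v -> K v.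
Proof.
move=> Vv; have [z hz] := addcat_zero B; apply: add_closure_sub.
exists z, v, 0, (idm v); split=> //; first exact: U_zero.
by exists 0; exact: realizes_0id.
Qed.

Lemma kernel_biprod a b s (i1 : mor a s) (i2 : mor b s) (p1 : mor s a)
    (p2 : mor s b) : is_biprod i1 i2 p1 p2 -> K a -> K b -> K s.
Proof.
move=> bp [S [[u [v [f [g [Uu Vv [d r]]]]]] hS]].
move=> [S' [[u' [v' [f' [g' [Uu' Vv' [d' r']]]]]] hS']].
have [us [j1 [j2 [q1 [q2 bpu]]]]] := addcat_biprod u u'.
have [vs [k1 [k2 [r1 [r2 bpv]]]]] := addcat_biprod v v'.
have [T [l1 [l2 [m1 [m2 bpT]]]]] := addcat_biprod S S'.
case: cp => [[[_ Ubp] _ _] [[_ Vbp] _ _] _ _ _].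
exists T; split; last exact: is_summand_biprod bp bpT hS hS'.
have rT := et2_sum bpu bpT bpv r r'.
eexists us, vs, _, _; split; last by eexists; exact: rT.
  exact: Ubp bpu Uu Uu'.
exact: Vbp bpv Vv Vv'.
Qed.

Lemma kernel_additive : is_additive_subcat K.
Proof.
split; last exact: kernel_biprod.
have [z hz] := addcat_zero B; exists z; split=> //.
exact/U_kernel/U_zero.
Qed.

(** If k (+) k' lies in U * V, the direct sum of the given conflation with the
    identity of k' extends k (+) k' by [v], and V is closed under extensions. *)
Lemma kernel_ext_V k x v (f : mor k x) (g : mor x v) :
  conflation f g -> K k -> V v -> K x.
Proof.
case=> d r [S [[u [v1 [h [l [Uu Vv1 [d' r']]]]]] hS]] Vv.
have [k' [i1 [i2 [p1 [p2 bp]]]]] := hS.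
have [z hz] := addcat_zero B.
have [t [j1 [j2 [q1 [q2 bpt]]]]] := addcat_biprod x k'.
have rt := et2_sum bp bpt (is_biprod0 v hz) r (realizes_id0 k' hz).
have [e [m [n [o [dl [_ [rs [re _ _]]]]]]]] := et4 r' rt.
exists t; split; last by exists k', j1, j2, q1, q2.
do 4!eexists; split; [exact: Uu | | by exists dl; exact: rs].
apply: V_ext Vv1 Vv; eexists; exact: re.
Qed.

Lemma coheart_U c : C c -> U c.
Proof. by move=> hc; apply: U_perp => v d Vv; apply: hc; exact: V_kernel. Qed.

Lemma coheart_ext_U c u (d : ext c u) : C c -> U u -> d = 0.
Proof. by move=> hc Uu; apply: hc; exact: U_kernel. Qed.

(** * Null morphisms *)

Lemma null0 a b : null (0 : mor a b).
Proof. exact/(factor_predP (core_additive cp))/rpred0. Qed.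

Lemma null_add a b (f g : mor a b) : null f -> null g -> null (f + g).
Proof.
move=> /(factor_predP (core_additive cp)) hf.
move=> /(factor_predP (core_additive cp)) hg.
exact/(factor_predP (core_additive cp))/rpredD.
Qed.

Lemma null_opp a b (f : mor a b) : null f -> null (- f).
Proof.
case=> w [Ww [g [h ->]]]; exists w; split=> //.
by exists g, (- h); rewrite cmpNm.
Qed.

Lemma null_of_sub a b (f g : mor a b) : null (f - g) -> null g -> null f.
Proof. by move=> h1 h2; rewrite -[f](subrK g); exact: null_add. Qed.

Lemma null_core_l w a (f : mor w a) : W w -> null f.
Proof. by move=> Ww; exists w; split=> //; exists (idm w), f; rewrite cmpm1. Qed.

Lemma null_core_r w a (f : mor a w) : W w -> null f.
Proof. by move=> Ww; exists w; split=> //; exists f, (idm w); rewrite cmp1m. Qed.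

(** Because the core lies in U, which E(c, -) annihilates. *)
Lemma null_push_coheart a b c (f : mor a b) (d : ext c a) :
  null f -> C c -> push f d = 0.
Proof.
case=> w [[Uw _] [g [h ->]]] hc.
by rewrite pushM [push g d]coheart_ext_U // push0r.
Qed.

Lemma null_extend a b u y (x : mor a b) (q : mor b u) (f : mor a y) :
  conflation x q -> U u -> null f -> exists g : mor b y, null g /\ g \oc x = f.
Proof.
case=> d r Uu [w [Ww [g [h ->]]]].
have [g' <-] : exists g', g' \oc x = g.
  by apply: (conf_ext r); apply: (ext_UV cp) => //; case: Ww.
exists (h \oc g'); rewrite cmpA; split=> //.
by exists w; split=> //; exists g', h.
Qed.

Lemma null_UV u v (f : mor u v) : U u -> V v -> null f.
Proof.
move=> Uu Vv; case: cp => _ _ _ _ /(_ u)[v1 [u1 [i [q [Vv1 Uu1 cf]]]]].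
have Wv1 : W v1 by split=> //; exact: U_ext cf Uu Uu1.
case: cf => d r; have [g <-] : exists g, g \oc i = f.
  by apply: (conf_ext r); exact: (ext_UV cp).
by exists v1; split=> //; exists i, g.
Qed.

(** In the exact sequence of E(-, v) at b >-> v' ->> u', restriction to [b]
    factors through a null morphism and hence vanishes, so that E(v', v) = 0. *)
Lemma BminusP b : Bminus U V b <-> forall v (f : mor b v), V v -> null f.
Proof.
split=> [[w [u [i [q [[Uw Vw] Uu [d r]]]]]] v f Vv | h].
  have [g <-] : exists g, g \oc i = f.
    by apply: (conf_ext r); exact: (ext_UV cp).
  by exists w; split=> //; exists i, g.
case: cp => _ _ _ _ /(_ b)[v' [u' [i [q [Vv' Uu' [d r]]]]]].
exists v', u', i, q; split=> //; last by exists d.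
split=> //; apply: U_perp => v t Vv.
have [w [[Uw _] [g [k ei]]]] := h _ i Vv'.
have [t' ->] : exists t', t = pull q t'.
  apply: (conf_ext_pull r).
  by rewrite ei pullM [pull k t](ext_UV cp) // pull0r.
by rewrite (ext_UV cp t') // pull0r.
Qed.

Lemma BplusP b : Bplus U V b <-> forall u (f : mor u b), U u -> null f.
Proof.
split=> [[v [w [i [q [Vv [Uw Vw] [d r]]]]]] u f Uu | h].
  have [g <-] : exists g, q \oc g = f.
    by apply: (conf_colift r); exact: (ext_UV cp).
  by exists w; split=> //; exists g, q.
case: cp => _ _ _ /(_ b)[v' [u' [i [q [Vv' Uu' [d r]]]]]] _.
exists v', u', i, q; split=> //; last by exists d.
split=> //; apply: (V_perp cp) => u t Uu.
have [w [[_ Vw] [g [k eq]]]] := h _ q Uu'.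
have [t' ->] : exists t', t = push i t'.
  apply: (conf_ext_push r).
  by rewrite eq pushM [push g t](ext_UV cp) // push0r.
by rewrite (ext_UV cp t') // push0r.
Qed.

Lemma null_Bminus_V b v (f : mor b v) : Bminus U V b -> V v -> null f.
Proof. by move=> /BminusP; apply. Qed.

Lemma null_U_Bplus u b (f : mor u b) : U u -> Bplus U V b -> null f.
Proof. by move=> Uu /BplusP; apply. Qed.

Lemma Bminus_ext b x u (f : mor b x) (g : mor x u) :
  conflation f g -> Bminus U V b -> U u -> Bminus U V x.
Proof.
move=> cf hb Uu; apply/BminusP => v h Vv.
have [k [hk ek]] := null_extend cf Uu (null_Bminus_V (h \oc f) hb Vv).
case: cf => d r; have [l el] : exists l, h - k = l \oc g.
  by apply: (conf_desc r); rewrite cmpBl ek subrr.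
apply: null_of_sub hk; rewrite el; apply: factors_cmpr.
exact: null_UV.
Qed.

Lemma Bminus_CoCone_U b p u (x : mor b p) (y : mor p u) :
  conflation x y -> U p -> U u -> Bminus U V b.
Proof.
case=> d r Up Uu; apply/BminusP => v f Vv.
have [g <-] : exists g, g \oc x = f by apply: (conf_ext r); exact: (ext_UV cp).
by apply: factors_cmpr; exact: null_UV.
Qed.

(** The functor H kills the kernel.  For a conflation u >-> k ->> v push its
    class out along u >-> w with [w] in the core, which gives w >-> e ->> v with
    [e] in V; a morphism from [k] to B^+ differs from one factoring through [e]
    by one factoring through [v], and both restrict to null morphisms on B^-. *)
Lemma null_through_kernel b k z (f : mor b k) (g : mor k z) :
  Bminus U V b -> K k -> Bplus U V z -> null (g \oc f).
Proof.
move=> hb [s [[u [v [x [y [Uu Vv [d r]]]]]] hks]] hz.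
have [_ [i [_ [p [_ [epi _ _ _ _]]]]]] := hks.
suff h (f' : mor b s) (g' : mor s z) : null (g' \oc f').
  by rewrite -[f]cmp1m -epi -cmpA cmpA; exact: h.
have [w [Ww [l [m em]]]] := null_U_Bplus (g' \oc x) Uu hz.
have [e [j [q re]]] := realizable (push l d).
have Ve : V e by apply: V_ext Vv; [eexists; exact: re | case: Ww].
have [|o [eo _]] := et2_morphism (f := l) (h := idm v) r re.
  by rewrite pull1.
have [n en] : exists n, n \oc j = m.
  by apply: (conf_ext re); rewrite -pushM -em pushM (conf_push0 r) push0r.
have [t et] : exists t, g' - n \oc o = t \oc y.
  by apply: (conf_desc r); rewrite cmpBl -cmpA eo cmpA en em subrr.
rewrite -[g'](subrK (n \oc o)) et cmpDl -!cmpA.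
by apply: null_add; apply: factors_cmpl; exact: null_Bminus_V.
Qed.

(** * Reflections *)

Lemma reflection_Bminus b z (p : mor b z) :
  is_reflection U V p -> Bminus U V b -> Bminus U V z.
Proof. by case=> _ [u [q [Uu cf]]] _ hb; exact: Bminus_ext cf hb Uu. Qed.

Lemma reflection_heart b z (p : mor b z) :
  is_reflection U V p -> Bminus U V b -> heart_pred U V z.
Proof. by move=> hp hb; split; [case: hp | exact: reflection_Bminus hp hb]. Qed.

Lemma reflection_factor b z (p : mor b z) y (f : mor b y) :
  is_reflection U V p -> Bplus U V y -> exists g, null (g \oc p - f).
Proof.
move=> hp hy.
have [g0 [eg _]] := reflection_universal (fmap (stable_pi cp) f) hp hy.
have [g e] := stable_pi_surj g0; exists g; apply/(stable_piP cp).
by rewrite -stable_piM -e.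
Qed.

(** The surjectivity of p^* on E(-, v) turns nullity of [p] into E(b, v) = 0. *)
Lemma U_of_null_reflection b z (p : mor b z) :
  is_reflection U V p -> null p -> U b.
Proof.
move=> [_ _ sur] [w [[Uw _] [g [h ep]]]]; apply: U_perp => v t Vv.
have [t' <-] := sur v Vv t.
by rewrite ep pullM [pull h t'](ext_UV cp) // pull0r.
Qed.

Section WithReflections.
Variable rc : reflection_choice U V.

(** The reflection of [x] is a test object: right exactness of H makes H x a
    quotient of H y, so it vanishes as soon as y -> x is killed in the heart. *)
Lemma U_of_null_into_heart y x u (m : mor y x) (q : mor x u) :
  conflation m q -> Bminus U V y -> U u ->
  (forall z (f : mor x z), heart_pred U V z -> null (f \oc m)) -> U x.
Proof.
move=> cf hy Uu h; have hx := Bminus_ext cf hy Uu.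
have hp := reflP rc x; set p := projT2 _ in hp.
have hz := reflection_heart hp hx.
have [k [hk ek]] := null_extend cf Uu (h _ p hz).
apply: (U_of_null_reflection hp); apply: null_of_sub hk.
case: cf => d r; have [l ->] : exists l, p - k = l \oc q.
  by apply: (conf_desc r); rewrite cmpBl ek subrr.
by apply: factors_cmpr; apply: null_U_Bplus => //; case: hz.
Qed.

(** The property of being an epimorphism of the heart, read off from a
    representative; see [heart_epiP]. *)
Definition heart_epi x y (f : mor x y) : Prop :=
  forall z (g : mor y z), heart_pred U V z -> null (g \oc f) -> null g.

(** * Syzygies of the coheart *)

(** A morphism from a syzygy to B^+ is null as soon as its class in E(c, -)
    vanishes: a map that extends to [p] factors through an object of U. *)
Lemma syzygy_null a p c (e : ext c a) (x : mor a p) (y : mor p c) z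
    (f : mor a z) :
  realizes e x y -> ext_projective p -> Bplus U V z -> push f e = 0 -> null f.
Proof.
move=> r hp hz /(conf_ext r)[g <-]; apply: factors_cmpr.
by apply: null_U_Bplus => //; exact: projective_U.
Qed.

Lemma syzygy_class a p c (e : ext c a) (x : mor a p) (y : mor p c) z
    (t : ext c z) :
  realizes e x y -> ext_projective p -> exists f : mor a z, t = push f e.
Proof. by move=> r hp; apply: (conf_pull_ker r); exact: hp. Qed.

(** With X >-> w ->> u, [w] in the core, the push-out of its class along an
    epimorphism X -> Y of the heart is a class Y >-> m ->> u with [m] in U, by
    right exactness.  As E(c, m) = 0, every class in E(c, Y) is pulled back
    from it and therefore comes from E(c, X). *)
Lemma syzygy_projective a p c (e : ext c a) (i : mor a p) (q : mor p c) z0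
    (r0 : mor a z0) x y (h : mor x y) (f : mor z0 y) :
  realizes e i q -> ext_projective p -> C c -> is_reflection U V r0 ->
  heart_pred U V x -> heart_pred U V y -> heart_epi h ->
  exists g : mor z0 x, null (h \oc g - f).
Proof.
move=> r hp hc hr0 [xp xm] [yp ym] he.
have [w [u [j [k [Ww Uu [dx rx]]]]]] := xm.
have [m [jm [km rm]]] := realizable (push h dx).
have Um : U m.
  apply: (U_of_null_into_heart _ ym Uu); first by eexists; exact: rm.
  move=> z s hz; apply: he => //.
  have [l <-] : exists l, l \oc j = s \oc jm \oc h.
    by apply: (conf_ext rx); rewrite !pushM -pushM pushM (conf_push0 rm) push0r.
  by apply: factors_cmpr; exact: null_core_l.
have [b eb] : exists b : mor c u, push (f \oc r0) e = pull b (push h dx).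
  by apply: (conf_push_ker rm); exact: coheart_ext_U.
have [g0 eg0] := syzygy_class (pull b dx) r hp.
have [g hg] := reflection_factor g0 hr0 xp.
exists g; apply: (reflection_inj cp hr0 yp).
rewrite cmpBl -cmpA; apply: (@null_of_sub _ _ _ (h \oc g0 - f \oc r0)).
  rewrite opprB addrA subrK -cmpBr; exact: factors_cmpl.
apply: (syzygy_null r hp yp).
by rewrite pushBl pushM -eg0 push_pull eb subrr.
Qed.

(** Let z be the reflection of [y] and g : z0 -> z an epimorphism of the heart
    from the reflection z0 of a syzygy of [c].  The class in E(c, z) of [g]
    lifts to E(c, y) because E(c, U) = 0; the extension it defines has middle
    term in U, since a map from [y] to the heart that extends to it induces a map
    from z that is killed by [g]. *)
Lemma Bminus_CoCone_coheart a p c (e : ext c a) (i : mor a p) (q : mor p c) z0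
    (r0 : mor a z0) y z (r1 : mor y z) (g : mor z0 z) :
  realizes e i q -> ext_projective p -> C c -> is_reflection U V r0 ->
  Bminus U V y -> is_reflection U V r1 -> heart_epi g -> CoCone U C y.
Proof.
move=> r hp hc hr0 ym hr1 hg.
have [zp [u [qu [Uu [du ru]]]] _] := hr1.
have [t et] : exists t, push (g \oc r0) e = push r1 t.
  by apply: (conf_ext_push ru); exact: coheart_ext_U.
have [x [m [n rx]]] := realizable t.
exists x, c, m, n; split=> //; last by exists t.
apply: (U_of_null_into_heart _ ym (coheart_U hc)); first by exists t; exact: rx.
move=> T f [Tp Tm].
have [s hs] := reflection_factor (f \oc m) hr1 Tp.
suff ns : null s.
  apply: (@null_of_sub _ _ _ (s \oc r1)); last exact: factors_cmpr.
  by rewrite -opprB; exact: null_opp.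
apply: hg; first by split.
apply: (reflection_inj cp hr0 Tp).
apply: (syzygy_null r hp Tp).
rewrite -cmpA pushM et -pushM -[s \oc r1](subrK (f \oc m)) pushDl.
by rewrite (null_push_coheart _ hs hc) pushM (conf_push0 rx) push0r addr0.
Qed.

(** Along b >-> k ->> c with [k] in the kernel, whose class is f_* e for a map
    [f] from a syzygy, a morphism from [b] killing [f] up to null morphisms
    extends to [k], and H kills [k]. *)
Lemma heart_epi_of_CoCone_kernel a p c (e : ext c a) (i : mor a p)
    (q : mor p c) z0 (r0 : mor a z0) b k (m : mor b k) (n : mor k c)
    (g : mor z0 b) :
  realizes e i q -> C c -> is_reflection U V r0 -> Bminus U V b -> K k ->
  forall f : mor a b, realizes (push f e) m n -> null (g \oc r0 - f) ->
  heart_epi g.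
Proof.
move=> r hc hr0 bm Kk f rm hf z h [zp zm] nh.
have nhf : null (h \oc f).
  apply: (@null_of_sub _ _ _ (h \oc g \oc r0)); last exact: factors_cmpr.
  by rewrite -cmpA -cmpBr -opprB; apply/factors_cmpl/null_opp.
have [l <-] : exists l, l \oc m = h.
  by apply: (conf_ext rm); rewrite -pushM; exact: null_push_coheart.
exact: null_through_kernel.
Qed.

End WithReflections.

(** * The heart *)

Section Heart.
Variables (rc : reflection_choice U V) (cc : coreflection_choice U V).
Local Notation Ht := (heart cp).
Local Notation H := (H_functor cp rc cc).

Definition heart_mor (x y : Ht) (f : @mor B (sval x) (sval y)) :
  @mor Ht x y := fmap (stable_pi cp) f.

Lemma heart_mor_surj (x y : Ht) (f : @mor Ht x y) : exists g, f = heart_mor g.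
Proof. exact: (stable_pi_surj (cp := cp)). Qed.

Lemma heart_morP (x y : Ht) (f g : @mor B (sval x) (sval y)) :
  heart_mor f = heart_mor g <-> null (f - g).
Proof. exact: (stable_piP cp). Qed.

Lemma heart_morM (x y z : Ht) (g : @mor B (sval y) (sval z))
    (f : @mor B (sval x) (sval y)) :
  heart_mor g \oc heart_mor f = heart_mor (g \oc f).
Proof. exact: (stable_piM cp). Qed.

Lemma heart_morD (x y : Ht) (f g : @mor B (sval x) (sval y)) :
  heart_mor f + heart_mor g = heart_mor (f + g).
Proof. exact: (esym (quot_piD _ _ _)). Qed.

Lemma heart_mor1 (x : Ht) : idm x = heart_mor (@idm B (sval x)).
Proof. by []. Qed.

Lemma heart_mor0 (x y : Ht) : 0 = heart_mor (0 : @mor B (sval x) (sval y)).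
Proof. by apply: (@addrI _ (heart_mor 0)); rewrite heart_morD !addr0. Qed.

Lemma heart_epiP (x y : Ht) (f : @mor B (sval x) (sval y)) :
  is_epi (heart_mor f) <-> heart_epi f.
Proof.
split=> [he z g hz hn | he z g h].
  have e : heart_mor (y := exist _ z hz) g = heart_mor 0.
    by apply: he; rewrite !heart_morM; apply/heart_morP; rewrite cmp0m subr0.
  by move/heart_morP: e; rewrite subr0.
have [g0 ->] := heart_mor_surj g; have [h0 ->] := heart_mor_surj h.
rewrite !heart_morM => /heart_morP; rewrite -cmpBl => /he hn.
by apply/heart_morP/hn; exact: svalP z.
Qed.

(** On B^- the coreflection of the reflection is the identity, so that H is the
    reflection itself. *)
Lemma H_reflection a : Bminus U V a ->
  exists p : mor a (sval (H a)), is_reflection U V p.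
Proof.
move=> ha; have hr := reflP rc a; have hz := reflection_Bminus hr ha.
change (exists p : mor a (projT1 (corefl cc (projT1 (refl rc a)))),
  is_reflection U V p).
by rewrite (corefl_id cc hz) /=; exists (projT2 (refl rc a)).
Qed.

Lemma Omega_reflection a : Omega C a ->
  exists p c (x : mor a p) (y : mor p c) (e : ext c a)
    (r0 : mor a (sval (H a))),
  [/\ realizes e x y, ext_projective p, C c & is_reflection U V r0].
Proof.
case=> p [c [x [y [hp hc [e r]]]]].
have [|r0 hr0] := @H_reflection a.
  apply: (Bminus_CoCone_U (x := x) (y := y)); first by exists e.
    exact: projective_U.
  exact: coheart_U.
by exists p, c, x, y, e, r0.
Qed.

Lemma cat_projective_retract (D : preaddcat) (a b : D) (s : mor b a)
    (p : mor a b) : p \oc s = idm b -> cat_projective a -> cat_projective b.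
Proof.
move=> e ha c d h f he; have [g eg] := ha c d h (f \oc p) he.
by exists (g \oc s); rewrite cmpA eg -cmpA e cmpm1.
Qed.

Lemma H_Omega_projective (x : Ht) :
  ess_image H (Omega C) x -> cat_projective x.
Proof.
case=> a [ha [f [g [_ efg]]]]; apply: cat_projective_retract efg _.
have [p [c [i [q [e [r0 [r hp hc hr0]]]]]]] := Omega_reflection ha.
move=> y z h k; have [h0 ->] := heart_mor_surj h.
have [k0 ->] := heart_mor_surj k => /heart_epiP he.
have [l hl] := syzygy_projective rc k0 r hp hc hr0 (svalP y) (svalP z) he.
by exists (heart_mor l); rewrite heart_morM; apply/heart_morP.
Qed.

(** Idempotents of the ambient category need not split.  If f s = 1 + (a map
    through the core), add to [s] an inflation of [y] into the core to obtain
    an inflation of [y] into x (+) w that has a retraction in the ambient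
    category; as [w] vanishes in the heart, its complement serves there too. *)
Lemma heart_summand (x y : Ht) (f : @mor Ht x y) (s : @mor Ht y x) :
  f \oc s = idm y -> is_summand y x.
Proof.
have [f0 ->] := heart_mor_surj f; have [s0 ->] := heart_mor_surj s.
rewrite heart_morM heart_mor1 => /heart_morP[w0 [[Uw0 Vw0] [h [k ehk]]]].
have [hxp hxm] := svalP x; have [hyp hym] := svalP y.
have [w [u [j [q [Ww Uu [d r]]]]]] := hym.
have [h' eh] : exists h', h' \oc j = h.
  by apply: (conf_ext r); exact: (ext_UV cp).
have [S [i1 [i2 [p1 [p2 bp]]]]] := addcat_biprod (sval x) w.
have [t [q' [D rD]]] := inflation_biprod s0 r bp.
have E := is_biprodE bp.
pose I := i1 \oc s0 + i2 \oc j; pose R := f0 \oc p1 - k \oc h' \oc p2.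
have eRI : R \oc I = @idm B (sval y).
  rewrite /R /I cmpBl; biprod_simpl E; rewrite -?cmpA eh -ehk.
  by rewrite opprB addrC subrK.
have [n bn] := biprod_of_retraction rD eRI.
have [_ enq eRn eqI esum] := bn.
(* [S] and its summand [x] agree up to morphisms through [w]. *)
have drop a b (f1 : mor S b) (f2 : mor a S) :
    null (f1 \oc i1 \oc (p1 \oc f2) - f1 \oc f2).
  rewrite -[X in _ - f1 \oc X](is_biprod_sum bp) cmpDr -!cmpA opprD addrA subrr.
  rewrite sub0r; apply: null_opp; apply: factors_cmpl.
  by apply: factors_cmpr; exact: null_core_l.
have nullS b c (f1 : mor b S) (f2 : mor S c) :
    null (f2 \oc i1) -> null (f2 \oc f1).
  move=> hn; rewrite -[f1](is_biprod_sum bp) cmpDr !cmpA.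
  by apply: null_add; do 2!apply: factors_cmpr => //; apply: null_core_l.
have nullS' b c (f1 : mor b S) (f2 : mor S c) :
    null (p1 \oc f1) -> null (f2 \oc f1).
  move=> hn; rewrite -[f1](is_biprod_sum bp) cmpDr.
  by apply: null_add; do 2!apply: factors_cmpl => //; apply: null_core_r.
have ht : heart_pred U V t.
  split; [apply/BplusP => u' g Uu' | apply/BminusP => v g Vv].
    rewrite -[g]cmp1m -enq -cmpA; apply: nullS'.
    exact: null_U_Bplus.
  rewrite -[g]cmpm1 -enq cmpA; apply: nullS.
  exact: null_Bminus_V.
pose T : Ht := exist _ t ht.
exists T, (heart_mor (p1 \oc I)), (heart_mor (x := T) (p1 \oc n)),
  (heart_mor (R \oc i1)), (heart_mor (y := T) (q' \oc i1)).
split; rewrite !heart_morM ?heart_morD ?heart_mor1 ?heart_mor0.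
all: apply/heart_morP.
- by rewrite -eRI; exact: drop.
- by rewrite -enq; exact: drop.
- by rewrite -eRn; exact: drop.
- by rewrite -eqI; exact: drop.
have := congr1 (fun g => p1 \oc (g \oc i1)) esum.
by rewrite cmp1m cmpDl cmpDr -!cmpA E => ->; rewrite subrr; exact: null0.
Qed.

(** * The equivalent conditions *)

Hypothesis hB : enough_ext_projectives B.

Definition enough_H_Omega : Prop :=
  forall b : Ht, exists x : Ht, ess_image H (Omega C) x /\
    exists f : mor x b, is_epi f.

(** The syzygy of [u] lies in B^-, so the assumption at its reflection embeds it
    into an object of U with cokernel in the coheart; the push-out along it replaces the projective
    object over [u] by one of the coheart. *)
Lemma U_Cone_of_enough u : enough_H_Omega -> U u -> Cone K C u.
Proof.
move=> h1 Uu; have [p [hp [q [y [i [d r]]]]]] := hB u.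
have ym : Bminus U V y.
  by apply: (Bminus_CoCone_U _ _ Uu); [exists d; exact: r | exact: projective_U].
have hr := reflP rc y; have hz := reflection_heart hr ym.
have [x [[a [ha [f [g [_ efg]]]]] [e he]]] := h1 (exist _ _ hz).
have {he} : is_epi (e \oc f).
  move=> b k l; rewrite !cmpA => /(congr1 (fun m => m \oc g)).
  by rewrite -!cmpA efg !cmpm1; exact: he.
have [s ->] := heart_mor_surj (e \oc f) => /heart_epiP he.
have [p' [c [i' [q' [e' [r0 [r' hp' hc hr0]]]]]]] := Omega_reflection ha.
have [X [c' [m [n [UX hc' [d' rX]]]]]] :=
  Bminus_CoCone_coheart rc r' hp' hc hr0 ym hr he.
have [E [m1 [n1 [rE [P [m2 [n2 [isoP [d2 r2]]]]]]]]] := conf_pushout rX r.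
exists X, E, m1, n1; split; [exact: U_kernel | | by eexists; exact: rE].
by apply: (lperp_ext r2) hc'; apply: lperp_iso isoP _ => z t _; exact: hp.
Qed.

(** The deflations of C-objects onto U extend to all objects because each
    object is a quotient of one in U with kernel in V; pulled back along
    v ->> u they give k >-> e ->> v, whose middle term is in the kernel and
    contains [b] with cokernel in C. *)
Lemma coheart_cotorsion_of_Cone :
  (forall u, U u -> Cone K C u) -> is_cotorsion_pair C K.
Proof.
move=> h; split.
- split; [exact: lperp_additive | exact: lperp_summand | exact: lperp_iso].
- split; [exact: kernel_additive | exact: add_closure_summand |].
  exact: add_closure_iso.
- by move=> c k d hc Kk; exact: hc.
- move=> b; case: cp => _ _ _ /(_ b)[v [u [i [q [Vv Uu [d r]]]]]] _.
  have [k [c [j [s [Kk Cc [d' r']]]]]] := h u Uu.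
  have [E [m [n [l [dl [_ [rl [re _ _]]]]]]]] := et4op r r'.
  exists E, c, l, (q \oc s); split=> //; last by exists dl.
  by apply: kernel_ext_V Kk Vv; eexists; exact: re.
move=> b; case: cp => _ _ _ _ /(_ b)[v [u [i [q [Vv Uu [d r]]]]]].
have [k [c [j [s [Kk Cc [d' r']]]]]] := h u Uu.
have [E [m [n [rE [c' [m' [n' [isoc cf]]]]]]]] := conf_pullback r r'.
exists E, c', m', n'; split=> //; last exact: lperp_iso isoc Cc.
by apply: kernel_ext_V Kk Vv; eexists; exact: rE.
Qed.

Lemma enough_of_CoCone : (forall b, CoCone K C b) -> enough_H_Omega.
Proof.
move=> h3 b; have [bp bm] := svalP b.
have [k [c [m [n [Kk Cc [d r]]]]]] := h3 (sval b).
have [p [hp [y [a [x [e re]]]]]] := hB c.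
have ha : Omega C a by exists p, c, x, y; split=> //; exists e.
have [|r0 hr0] := @H_reflection a.
  apply: (Bminus_CoCone_U (x := x) (y := y)); first by exists e.
    exact: projective_U.
  exact: coheart_U.
have [f ef] := syzygy_class d re hp.
have [g hg] := reflection_factor f hr0 bp.
exists (H a); split.
  by exists a; split=> //; exists (idm _), (idm _); rewrite cmp1m.
exists (heart_mor (x := H a) (y := b) g); apply/heart_epiP.
apply: (heart_epi_of_CoCone_kernel re Cc hr0 bm Kk _ hg).
by rewrite -ef; exact: r.
Qed.

Lemma projective_add_H_Omega (x : Ht) : enough_H_Omega ->
  cat_projective x <-> add_closure (ess_image H (Omega C)) x.
Proof.
move=> h1; split=> [hx | [y [hy [z [i1 [_ [p1 [_ [e _ _ _ _]]]]]]]]].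
  have [y [hy [e he]]] := h1 x; have [s es] := hx _ _ e (idm x) he.
  by exists y; split=> //; exact: heart_summand es.
exact: cat_projective_retract e (H_Omega_projective hy).
Qed.

End Heart.

End CotorsionPair.

Theorem theorem4p10 (B : extricat) (hB : enough_ext_projectives B)
    (U V : B -> Prop) (cp : is_cotorsion_pair U V)
    (rc : reflection_choice U V) (cc : coreflection_choice U V) :
  let C := coheart U V in
  let K := kernel U V in
  let HOmegaC : heart cp -> Prop := ess_image (H_functor cp rc cc) (Omega C) in
  let cond1 := forall b : heart cp,
    exists x : heart cp, HOmegaC x /\ exists f : mor x b, is_epi f in
  let cond2 := is_cotorsion_pair C K in
  let cond3 := forall b : B, CoCone K C b in
  let cond4 := forall u : B, U u -> Cone K C u in
  ((cond1 <-> cond2) /\ (cond1 <-> cond3) /\ (cond1 <-> cond4)) /\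
  (forall x : heart cp, HOmegaC x -> cat_projective x) /\
  (cond1 -> cat_enough_projectives (heart cp)) /\
  (cond1 -> forall x : heart cp, cat_projective x <-> add_closure HOmegaC x).
Proof.
move=> C K HOmegaC cond1 cond2 cond3 cond4.
have h14 : cond1 -> cond4 by move=> h u; exact: U_Cone_of_enough h.
have h42 : cond4 -> cond2 := @coheart_cotorsion_of_Cone _ _ _ cp.
have h23 : cond2 -> cond3 by case.
have h31 : cond3 -> cond1 := @enough_of_CoCone _ _ _ cp rc cc hB.
have hproj x : HOmegaC x -> cat_projective x by exact: H_Omega_projective.
split; first by tauto.
split=> //; split=> [h1 b | h1 x]; last exact: projective_add_H_Omega.
by have [x [/hproj hx he]] := h1 b; exists x.
Qed.
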